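(* Let $L$ be a relational language with finitely many relation symbols of every arity greater than one and with finitely or countably many unary relation symbols, and let $\mathbf H$ be a countable unrestricted $L$-structure in which all relations are injective. Then $\mathbf H$ has finite big Ramsey degrees.
   Context: Convention: every structure is countable, has vertex set some $n\in\omega$ or $\omega$ (so it carries the natural order $\le$ of the integers as an enumeration), and all embeddings are embeddings of $L$-structures (injective maps preserving and reflecting every relation) that are moreover monotone with respect to $\le$. For structures $\mathbf A,\mathbf B$, $\binom{\mathbf B}{\mathbf A}$ denotes the set of all such embeddings $\mathbf A\to\mathbf B$. A relation $R$ is injective in $\mathbf A$ if no tuple of $R^{\mathbf A}$ contains a repeated vertex. For a countably infinite structure $\mathbf B$ and a finite substructure $\mathbf A$, the big Ramsey degree of $\mathbf A$ in $\mathbf B$ is the least $\ell\in\omega+1$ such that for every $k\in\omega$ and every colouring $\chi:\binom{\mathbf B}{\mathbf A}\to k$ there is an embedding $f:\mathbf B\to\mathbf B$ such that $\chi$ takes at most $\ell$ values on the embeddings $\mathbf A\to\mathbf B$ whose image lies in $f[B]$. $\mathbf B$ has finite big Ramsey degrees if this number is finite for every finite substructure $\mathbf A$ of $\mathbf B$. An $L$-structure $\mathbf F$ is covered by a relation if there are $R\in L$ and a tuple $\bar x\in R^{\mathbf F}$ containing all vertices of $\mathbf F$. For a family $\mathcal F$ of $L$-structures, $\mathbf A$ is $\mathcal F$-free if no $\mathbf F\in\mathcal F$ embeds into $\mathbf A$. A structure $\mathbf A$ is universal for a class $\mathcal C$ if every member of $\mathcal C$ embeds into $\mathbf A$. An $L$-structure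 $\mathbf A$ is unrestricted if there is a family $\mathcal F$ of finite $L$-structures, each covered by a relation, such that $\mathbf A$ is $\mathcal F$-free and universal for all countable $\mathcal F$-free $L$-structures. *)

(* Defs.v *)
From Stdlib Require Import Arith List Lia.
Import ListNotations.




Definition inV (sz : option nat) (v : nat) : Prop :=
  match sz with Some n => v < n | None => True end.

Record struc (Sym : Type) (ar : Sym -> nat) : Type := Struc {
  size : option nat;
  rel : Sym -> list nat -> Prop;
  rel_wf : forall s t, rel s t -> length t = ar s /\ Forall (inV size) t
}.

Arguments size {Sym ar} _.
Arguments rel {Sym ar} _ _ _.

Definition inS {Sym ar} (A : struc Sym ar) (v : nat) : Prop := inV (size A) v.

(* Monotone embedding of L-structures A -> B (values of f outside the
   vertex set of A are irrelevant). *)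
Definition is_emb {Sym ar} (A B : struc Sym ar) (f : nat -> nat) : Prop :=
  (forall x, inS A x -> inS B (f x)) /\
  (forall x y, inS A x -> inS A y -> x < y -> f x < f y) /\
  (forall s t, length t = ar s -> Forall (inS A) t ->
     (rel A s t <-> rel B s (map f t))).

Definition all_rel_injective {Sym ar} (A : struc Sym ar) : Prop :=
  forall s t, rel A s t -> NoDup t.

Definition covered {Sym ar} (F : struc Sym ar) : Prop :=
  exists s t, rel F s t /\ forall v, inS F v -> In v t.

Definition is_finite {Sym ar} (A : struc Sym ar) : Prop :=
  exists n, size A = Some n.

Definition free {Sym ar} (Fam : struc Sym ar -> Prop) (A : struc Sym ar) : Prop :=
  forall F, Fam F -> ~ exists g, is_emb F A g.

Definition unrestricted {Sym ar} (A : struc Sym ar) : Prop :=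
  exists Fam : struc Sym ar -> Prop,
    (forall F, Fam F -> is_finite F /\ covered F) /\
    free Fam A /\
    (forall B, free Fam B -> exists g, is_emb B A g).

(* B has finite big Ramsey degrees. An embedding g of a finite structure A
   with vertex set n is identified with the tuple [g 0; ...; g (n-1)];
   a k-colouring is a map chi from such tuples to {0,...,k-1}. *)
Definition finite_big_ramsey_degrees {Sym ar} (B : struc Sym ar) : Prop :=
  forall (A : struc Sym ar) (n : nat), size A = Some n ->
    (exists g, is_emb A B g) ->
    exists l : nat, forall (k : nat) (chi : list nat -> nat),
      (forall e, chi e < k) ->
      exists f, is_emb B B f /\
        exists cs : list nat, length cs <= l /\
          forall g, is_emb A B g ->
            (forall x, inS A x -> exists y, inS B y /\ g x = f y) ->
            In (chi (map g (seq 0 n))) cs.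

(* Main.v *)
(** The type of a vertex over the first [n] vertices is a node of level [n] of a tree: it has one row for each
    [u < n], and that row is the joint type over the first [u] vertices of vertex [u] and the given vertex.  So nodes are
    hereditarily finite, each rank (the number of vertices whose joint type is described) and level has
    finitely many of them, and all arities are treated at once.  A self-map of the tree that sends the extension
    of [a] by the row [r] above the extension of [f a] by the least possible image of [r] (a copy) preserves all
    relations read off from the rows.

    Copies satisfy a Halpern-Lauchli theorem.  It is obtained from a left-variable Hales-Jewett theorem for words with
    infinitely many letters, proved with idempotent ultrafilters: rows are used as letters, and the image of a row is
    determined by the copy strictly below the level at which it becomes a letter.  Fusion then
    gives a Milliken theorem for finite chains of levels.

    Finally, the vertices of [H] are coded by nodes that branch only at levels set aside for this purpose, so that
    [n] coded vertices lie in a chain of one of boundedly many types.  The tree carries a structure that is free for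
    the forbidden family, hence embeds in [H] by universality, because a tuple of nodes is given relations only if
    some tuple of [H] has the same codes. *)
Require Import Defs.
From Stdlib Require Import Arith List Lia Sorted ClassicalEpsilon FunctionalExtensionality PropExtensionality.
From mathcomp.classical Require classical_sets.
Import ListNotations.

(** * Ultrafilters on words *)

(** The possible rows are finitely many at each level, but their number grows with the level, so no
    fixed finite alphabet suffices; each step of the word argument instead serves an arbitrary
    finite set of words and letters at once. There may be infinitely many unary relations, so unary
    types cannot enter the finitely many labels of nodes. They stay outside the tree: a vertex of
    the universal structure is a node together with the least vertex of [H] of the wanted unary
    type. Corresponding vertices in all copies of a finite [A] have the same unary type, so only the
    nodes have to be made homogeneous. Freeness rests on covering: realizing the covering tuple of a
    forbidden structure in [H] realizes that whole structure. The degree bound counts pairs of a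
    chain type and a list of positions. It is computed from the label counts [K] and the size of [A]
    alone, hence does not depend on the number of colours. *)

Definition choose {A : Type} (d : A) (P : A -> Prop) : A := epsilon (inhabits d) P.

Lemma choose_spec {A : Type} (d : A) (P : A -> Prop) : (exists x, P x) -> P (choose d P).
Proof. apply epsilon_spec. Qed.

(** Applied to filters, to left-invariant filters and to filters whose ultrafilters are closed under
    multiplication. A larger filter represents a smaller closed set of ultrafilters, so maximal
    elements stand for minimal closed sets. *)
Lemma zorn_above (T : Type) (Pr : (T -> Prop) -> Prop) (F0 : T -> Prop) :
  Pr F0 ->
  (forall C : (T -> Prop) -> Prop, (exists F, C F) -> (forall F, C F -> Pr F) ->
     (forall F G, C F -> C G -> (forall A, F A -> G A) \/ (forall A, G A -> F A)) ->
     Pr (fun A => exists F, C F /\ F A)) ->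
  exists F, Pr F /\ (forall A, F0 A -> F A) /\
    forall G, Pr G -> (forall A, F A -> G A) -> forall A, G A -> F A.
Proof.
  intros H0 Hch.
  pose (Q := fun F : T -> Prop => Pr F /\ forall A, F0 A -> F A).
  pose (t0 := exist Q F0 (conj H0 (fun A h => h))).
  pose (inc := fun x y : sig Q => forall A, proj1_sig x A -> proj1_sig y A).
  pose (R := fun x y : sig Q => if excluded_middle_informative (inc x y) then true else false).
  assert (RP : forall x y, is_true (R x y) <-> inc x y).
  { intros x y; unfold R; destruct (excluded_middle_informative (inc x y)) as [h|h]; split; intros h'; auto.
    discriminate. }
  destruct (@classical_sets.ZL_preorder (sig Q) t0 R) as [m Hm].
  - intros t; apply RP; intros A h; exact h.
  - intros r s t h1 h2; apply RP in h1; apply RP in h2; apply RP; intros A h; auto.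
  - intros A HA.
    destruct (classic (exists a, A a)) as [[a Ha]|Hno].
    2:{ exists t0; intros s Hs; exfalso; apply Hno; exists s; exact Hs. }
    pose (C := fun F : T -> Prop => exists s, A s /\ proj1_sig s = F).
    assert (HC : Q (fun B => exists F, C F /\ F B)).
    { split.
      - apply Hch.
        + exists (proj1_sig a), a; auto.
        + intros F [s [_ <-]]; exact (proj1 (proj2_sig s)).
        + intros F G [s [Hs <-]] [t [Ht <-]].
          destruct (HA s t Hs Ht) as [h|h]; apply RP in h; auto.
      - intros B HB; exists (proj1_sig a); split; [exists a; auto | apply (proj2 (proj2_sig a)); exact HB]. }
    exists (exist Q _ HC); intros s Hs; apply RP; intros B HB; simpl.
    exists (proj1_sig s); split; [exists s; auto|exact HB].
  - exists (proj1_sig m); destruct (proj2_sig m) as [h1 h2]; split; [exact h1|split; [exact h2|]].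
    intros G HG Hsub.
    assert (HQ : Q G) by (split; auto).
    specialize (Hm (exist Q G HQ)).
    assert (Hr : is_true (R (exist Q G HQ) m)) by (apply Hm, RP; exact Hsub).
    apply RP in Hr; exact Hr.
Qed.

Definition is_filter {S : Type} (F : (S -> Prop) -> Prop) : Prop :=
  F (fun _ => True) /\
  (forall A B : S -> Prop, F A -> (forall s, A s -> B s) -> F B) /\
  (forall A B : S -> Prop, F A -> F B -> F (fun s => A s /\ B s)) /\
  ~ F (fun _ => False).

Definition is_ultra {S : Type} (U : (S -> Prop) -> Prop) : Prop :=
  is_filter U /\ forall A, U A \/ U (fun s => ~ A s).

Section Filters.
Context {S : Type}.
Implicit Types (F U V W : (S -> Prop) -> Prop) (A B : S -> Prop).

Lemma filter_true F A : is_filter F -> (forall s, A s) -> F A.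
Proof. intros (h1 & h2 & _) HA; eapply h2; [exact h1|auto]. Qed.

Lemma filter_sub F A B : is_filter F -> F A -> (forall s, A s -> B s) -> F B.
Proof. intros (_ & h2 & _); apply h2. Qed.

Lemma filter_and F A B : is_filter F -> F A -> F B -> F (fun s => A s /\ B s).
Proof. intros (_ & _ & h3 & _); apply h3. Qed.

Lemma filter_ex F A : is_filter F -> F A -> exists s, A s.
Proof.
  intros (_ & h2 & _ & h4) HA; apply NNPP; intros Hno; apply h4; eapply h2; [exact HA|].
  intros s Hs; apply Hno; exists s; exact Hs.
Qed.

Lemma filter_forall_in {I : Type} F (l : list I) (P : I -> S -> Prop) :
  is_filter F -> (forall i, In i l -> F (P i)) -> F (fun s => forall i, In i l -> P i s).
Proof.
  intros HF; induction l as [|i l IH]; intros Hl.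
  - apply filter_true; [exact HF|intros s i []].
  - apply filter_sub with (A := fun s => P i s /\ forall j, In j l -> P j s).
    + exact HF.
    + apply filter_and; [exact HF|apply Hl; left; reflexivity|].
      apply IH; intros j Hj; apply Hl; right; exact Hj.
    + intros s [h1 h2] j [<-|Hj]; auto.
Qed.

Lemma ultra_not U A : is_ultra U -> U (fun s => ~ A s) -> ~ U A.
Proof.
  intros [HF _] h1 h2; destruct (filter_ex _ _ HF (filter_and _ _ _ HF h1 h2)) as [s [h h']]; auto.
Qed.

Lemma ultra_ext U V : is_ultra U -> is_ultra V -> (forall A, U A -> V A) -> U = V.
Proof.
  intros HU HV Hsub; apply functional_extensionality; intros A; apply propositional_extensionality.
  split; [apply Hsub|intros HA].
  destruct (proj2 HU A) as [h|h]; [exact h|exfalso].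
  apply (ultra_not _ _ HV (Hsub _ h) HA).
Qed.

Lemma filter_chain (C : ((S -> Prop) -> Prop) -> Prop) :
  (exists F, C F) -> (forall F, C F -> is_filter F) ->
  (forall F G, C F -> C G -> (forall A, F A -> G A) \/ (forall A, G A -> F A)) ->
  is_filter (fun A => exists F, C F /\ F A).
Proof.
  intros [F0 HF0] Hfil Htot; split; [|split; [|split]].
  - exists F0; split; [exact HF0|apply (Hfil _ HF0)].
  - intros A B [F [HF HA]] Hsub; exists F; split; [exact HF|eapply filter_sub; eauto].
  - intros A B [F [HF HA]] [G [HG HB]].
    destruct (Htot F G HF HG) as [h|h]; [exists G|exists F]; split; auto; apply filter_and; auto.
  - intros [F [HF HA]]; apply (proj2 (proj2 (proj2 (Hfil _ HF))) HA).
Qed.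

Lemma ultrafilter_above F : is_filter F -> exists U, is_ultra U /\ forall A, F A -> U A.
Proof.
  intros HF.
  destruct (zorn_above (S -> Prop) is_filter F HF filter_chain) as [U [HU [Hsub Hmax]]].
  exists U; split; [split; [exact HU|]|exact Hsub].
  intros A; destruct (classic (U (fun s => ~ A s))) as [h|h]; [right; exact h|left].
  (* The filter generated by [U] and [A], proper because the complement of [A] is not in [U]. *)
  pose (G := fun B => U (fun s => A s -> B s)).
  apply (Hmax G); unfold G.
  - split; [|split; [|split]].
    + apply filter_true; auto.
    + intros B B' HB Hs; eapply filter_sub; [exact HU|exact HB|]; simpl; auto.
    + intros B B' HB HB'; eapply filter_sub; [exact HU|apply (filter_and _ _ _ HU HB HB')|]; simpl; intuition.
    + exact h.
  - intros B HB; eapply filter_sub; [exact HU|exact HB|]; simpl; auto.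
  - apply filter_true; auto.
Qed.

(** If [A] were missing, the filter generated by [F] and the complement of [A] would extend to an
    ultrafilter avoiding [A]. So a filter is the intersection of the ultrafilters above it, and can
    stand for a closed set of them. *)
Lemma filter_mem_of_ultra F A :
  is_filter F -> (forall U, is_ultra U -> (forall B, F B -> U B) -> U A) -> F A.
Proof.
  intros HF HU; apply NNPP; intros HA.
  pose (G := fun B => F (fun s => ~ A s -> B s)).
  destruct (ultrafilter_above G) as [U [HUU Hsub]]; unfold G in *.
  - split; [|split; [|split]].
    + apply filter_true; auto.
    + intros B B' HB Hs; eapply filter_sub; [exact HF|exact HB|]; simpl; auto.
    + intros B B' HB HB'; eapply filter_sub; [exact HF|apply (filter_and _ _ _ HF HB HB')|]; simpl; intuition.
    + intros h; apply HA; eapply filter_sub; [exact HF|exact h|]; simpl; intros s hs; apply NNPP; exact hs.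
  - apply (ultra_not U A HUU).
    + apply Hsub; apply filter_true; auto.
    + apply HU; [exact HUU|]; intros B HB; apply Hsub; eapply filter_sub; [exact HF|exact HB|]; simpl; auto.
Qed.

Lemma ultra_of_base (base : (S -> Prop) -> Prop) :
  (exists A, base A) ->
  (forall A B, base A -> base B -> exists C, base C /\ forall s, C s -> A s /\ B s) ->
  (forall A, base A -> exists s, A s) ->
  exists U, is_ultra U /\ forall A, base A -> U A.
Proof.
  intros [A0 HA0] Hand Hex.
  destruct (ultrafilter_above (fun B => exists A, base A /\ forall s, A s -> B s)) as [U [HU Hsub]].
  - split; [|split; [|split]].
    + exists A0; auto.
    + intros A B [C [HC h]] h'; exists C; auto.
    + intros A B [C [HC h]] [C' [HC' h']]; destruct (Hand C C' HC HC') as [D [HD hD]].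
      exists D; split; [exact HD|]; intros s hs; destruct (hD s hs); auto.
    + intros [A [HA h]]; destruct (Hex A HA) as [s hs]; exact (h s hs).
  - exists U; split; [exact HU|]; intros A HA; apply Hsub; exists A; auto.
Qed.

Definition principal (s : S) : (S -> Prop) -> Prop := fun A => A s.

Lemma principal_ultra s : is_ultra (principal s).
Proof.
  unfold principal; split; [split; [|split; [|split]]|]; auto; intros A; apply classic.
Qed.

End Filters.

Definition push {S T : Type} (f : S -> T) (U : (S -> Prop) -> Prop) : (T -> Prop) -> Prop :=
  fun A => U (fun s => A (f s)).

Lemma push_ultra {S T : Type} (f : S -> T) (U : (S -> Prop) -> Prop) :
  is_ultra U -> is_ultra (push f U).
Proof.
  intros [HF HU]; unfold push; split; [split; [|split; [|split]]|].
  - apply filter_true; auto.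
  - intros A B HA h; eapply filter_sub; [exact HF|exact HA|]; simpl; auto.
  - intros A B HA HB; apply (filter_and _ _ _ HF HA HB).
  - apply (proj2 (proj2 (proj2 HF))).
  - intros A; apply (HU (fun s => A (f s))).
Qed.

(** * The semigroup of ultrafilters on words *)

Section WordUltrafilters.
Context {X : Type}.
Local Notation word := (list X).
Implicit Types (F U V W : (word -> Prop) -> Prop) (A B : word -> Prop).

(** Concatenation extended to ultrafilters. It is continuous in the left factor, so right
    multiplication sends closed sets to closed sets. *)
Definition umul U V : (word -> Prop) -> Prop := fun A => U (fun s => V (fun t => A (s ++ t))).

Lemma umul_ultra U V : is_ultra U -> is_ultra V -> is_ultra (umul U V).
Proof.
  intros [HF HU] [HG HV]; unfold umul; split; [split; [|split; [|split]]|].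
  - apply filter_true; [exact HF|intros s]; apply filter_true; auto.
  - intros A B HA h; eapply filter_sub; [exact HF|exact HA|]; simpl; intros s hs.
    eapply filter_sub; [exact HG|exact hs|]; simpl; auto.
  - intros A B HA HB; eapply filter_sub; [exact HF|apply (filter_and _ _ _ HF HA HB)|]; simpl.
    intros s [h1 h2]; apply (filter_and _ _ _ HG h1 h2).
  - intros h; destruct (filter_ex _ _ HF h) as [s hs]; apply (proj2 (proj2 (proj2 HG)) hs).
  - intros A; destruct (HU (fun s => V (fun t => A (s ++ t)))) as [h|h]; [left; exact h|right].
    eapply filter_sub; [exact HF|exact h|]; simpl; intros s hs.
    destruct (HV (fun t => A (s ++ t))) as [h'|h']; [contradiction|exact h'].
Qed.

Lemma umul_assoc U V W : umul (umul U V) W = umul U (umul V W).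
Proof.
  apply functional_extensionality; intros A; unfold umul; f_equal.
  apply functional_extensionality; intros s; f_equal.
  apply functional_extensionality; intros t; f_equal.
  apply functional_extensionality; intros r; rewrite app_assoc; reflexivity.
Qed.

(** The sets in the hypothesis form the filter of the closed left ideal of all products [umul V U].
    The factor comes from compactness: for [A] in [W], the sets of those [s] for which [U]-many [t]
    have [s ++ t] in [A] are nonempty and closed under intersection. *)
Lemma right_factor U W :
  is_ultra U -> is_ultra W ->
  (forall A, (forall s, U (fun t => A (s ++ t))) -> W A) ->
  exists V, is_ultra V /\ W = umul V U.
Proof.
  intros HU HW Hsub.
  destruct (ultra_of_base (fun B => exists A, W A /\ B = fun s => U (fun t => A (s ++ t)))) as [V [HV hV]].
  - exists (fun s => U (fun t => True)), (fun _ => True); split; [apply filter_true; [apply HW|auto]|reflexivity].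
  - intros B B' [A [HA ->]] [A' [HA' ->]].
    exists (fun s => U (fun t => A (s ++ t) /\ A' (s ++ t))); split.
    + exists (fun s => A s /\ A' s); split; [apply filter_and; auto; apply HW|reflexivity].
    + intros s hs; split; (eapply filter_sub; [apply HU|exact hs|]); simpl; intuition.
  - intros B [A [HA ->]]; apply NNPP; intros Hno.
    apply (ultra_not W A HW); [|exact HA].
    apply Hsub; intros s; destruct (proj2 HU (fun t => A (s ++ t))) as [h|h]; [|exact h].
    exfalso; apply Hno; exists s; exact h.
  - exists V; split; [exact HV|].
    apply ultra_ext; [exact HW|apply umul_ultra; auto|].
    intros A HA; apply (hV (fun s => U (fun t => A (s ++ t)))); exists A; auto.
Qed.

(** Closed sets of ultrafilters are represented by the filters below them, so a maximal left-invariant filter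
    represents a minimal closed left ideal. *)
Definition left_invariant F : Prop :=
  is_filter F /\ forall A, F A -> forall s, F (fun t => A (s ++ t)).

Lemma maximal_left_invariant F0 :
  left_invariant F0 ->
  exists F, left_invariant F /\ (forall A, F0 A -> F A) /\
    forall G, left_invariant G -> (forall A, F A -> G A) -> forall A, G A -> F A.
Proof.
  intros H0; apply zorn_above; [exact H0|].
  intros C Hex HC Htot; split.
  - apply filter_chain; [exact Hex|intros F HF; apply HC; exact HF|exact Htot].
  - intros A [F [HF HA]] s; exists F; split; [exact HF|]; apply (proj2 (HC F HF)); exact HA.
Qed.

Lemma left_invariant_mul F U V :
  left_invariant F -> is_ultra U -> (forall A, F A -> V A) -> forall A, F A -> umul U V A.
Proof.
  intros [_ HF] HU HV A HA; unfold umul; apply filter_true; [apply HU|]; intros s; apply HV, HF, HA.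
Qed.

(** The left multiples of [U] form a closed left ideal inside the one represented by [F]; maximality
    of [F] makes the two equal, and [right_factor] applies. *)
Lemma minimal_left_ideal F U W :
  left_invariant F ->
  (forall G, left_invariant G -> (forall A, F A -> G A) -> forall A, G A -> F A) ->
  is_ultra U -> (forall A, F A -> U A) -> is_ultra W -> (forall A, F A -> W A) ->
  exists V, is_ultra V /\ W = umul V U.
Proof.
  intros HF Hmax HU HUF HW HWF; apply right_factor; [exact HU|exact HW|].
  intros A HA; apply HWF; revert A HA.
  apply (Hmax (fun A => forall s, U (fun t => A (s ++ t)))).
  - split; [split; [|split; [|split]]|].
    + intros s; apply filter_true; [apply HU|auto].
    + intros A B HA h s; eapply filter_sub; [apply HU|apply (HA s)|]; simpl; auto.
    + intros A B HA HB s; apply (filter_and _ _ _ (proj1 HU) (HA s) (HB s)).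
    + intros h; apply (proj2 (proj2 (proj2 (proj1 HU))) (h [])).
    + intros A HA s s'; eapply filter_sub; [apply HU|apply (HA (s ++ s'))|]; simpl.
      intros t; rewrite app_assoc; auto.
  - intros A HA s; apply HUF, (proj2 HF), HA.
Qed.

(** Ellis' lemma for the closed set of ultrafilters above [F0]. *)
Lemma idempotent_above F0 :
  is_filter F0 ->
  (forall U V, is_ultra U -> is_ultra V -> (forall A, F0 A -> U A) -> (forall A, F0 A -> V A) ->
     forall A, F0 A -> umul U V A) ->
  exists e, is_ultra e /\ (forall A, F0 A -> e A) /\ umul e e = e.
Proof.
  intros HF0 Hsg0.
  pose (Pr := fun F => is_filter F /\
    forall U V, is_ultra U -> is_ultra V -> (forall A, F A -> U A) -> (forall A, F A -> V A) ->
     forall A, F A -> umul U V A).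
  destruct (zorn_above (word -> Prop) Pr F0) as [F [[HF Hsg] [Hsub Hmax]]].
  - split; assumption.
  - intros C Hex HC Htot; split.
    + apply filter_chain; [exact Hex|intros G HG; apply HC; exact HG|exact Htot].
    + intros U V HU HV hU hV A [G [HG HA]].
      apply (proj2 (HC G HG)); auto; intros B HB; [apply hU|apply hV]; exists G; auto.
  - destruct (ultrafilter_above F HF) as [e [He HeF]].
    exists e; split; [exact He|split; [auto|]].
    (* The filter [G] below represents the closed semigroup of all products [umul U e] with [U]
       above [F]. By maximality of [F] it contains every ultrafilter above [F], so [e] is itself
       such a product. *)
    assert (Hfac : exists U, is_ultra U /\ (forall A, F A -> U A) /\ e = umul U e).
    { pose (G := fun A => F (fun s => e (fun t => A (s ++ t)))).
      assert (HG : is_filter G).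
      { unfold G; split; [|split; [|split]].
        - apply filter_true; [exact HF|intros s]; apply filter_true; [apply He|auto].
        - intros A B HA h; eapply filter_sub; [exact HF|exact HA|]; simpl; intros s hs.
          eapply filter_sub; [apply He|exact hs|]; simpl; auto.
        - intros A B HA HB; eapply filter_sub; [exact HF|apply (filter_and _ _ _ HF HA HB)|]; simpl.
          intros s [h1 h2]; apply (filter_and _ _ _ (proj1 He) h1 h2).
        - intros h; destruct (filter_ex _ _ HF h) as [s hs]; apply (proj2 (proj2 (proj2 (proj1 He))) hs). }
      assert (HFG : forall A, F A -> G A).
      { intros A HA; unfold G; apply filter_mem_of_ultra; [exact HF|]; intros U HU hU.
        apply (Hsg U e HU He hU HeF A HA). }
      assert (Hrep : forall W, is_ultra W -> (forall A, G A -> W A) ->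
                exists U, is_ultra U /\ (forall A, F A -> U A) /\ W = umul U e).
      { intros W HW hW.
        destruct (ultra_of_base (fun B => exists A D, F D /\ W A /\ B = fun s => D s /\ e (fun t => A (s ++ t))))
          as [U [HU hU]].
        - exists (fun s => True /\ e (fun t => True)), (fun _ => True), (fun _ => True).
          split; [apply filter_true; auto|split; [apply filter_true; [apply HW|auto]|reflexivity]].
        - intros B B' (A & D & HD & HA & ->) (A' & D' & HD' & HA' & ->).
          exists (fun s => (D s /\ D' s) /\ e (fun t => A (s ++ t) /\ A' (s ++ t))); split.
          + exists (fun s => A s /\ A' s), (fun s => D s /\ D' s).
            split; [apply filter_and; auto|split; [apply filter_and; auto; apply HW|reflexivity]].
          + intros s [[h1 h2] hs]; split; (split; [assumption|]);
              (eapply filter_sub; [apply He|exact hs|]); simpl; intuition.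
        - intros B (A & D & HD & HA & ->); apply NNPP; intros Hno.
          apply (ultra_not W A HW); [|exact HA].
          apply hW; unfold G; eapply filter_sub; [exact HF|exact HD|]; simpl; intros s hs.
          destruct (proj2 He (fun t => A (s ++ t))) as [h|h]; [|exact h].
          exfalso; apply Hno; exists s; auto.
        - exists U; split; [exact HU|split].
          + intros D HD; eapply filter_sub with (A := fun s => D s /\ e (fun t => True)); [apply HU| |intros s hs; apply hs].
            apply hU; exists (fun _ => True), D; split; [exact HD|split; [apply filter_true; [apply HW|auto]|reflexivity]].
          + apply ultra_ext; [exact HW|apply umul_ultra; auto|]; intros A HA; unfold umul.
            eapply filter_sub with (A := fun s => True /\ e (fun t => A (s ++ t))); [apply HU| |intros s hs; apply hs].
            apply hU; exists A, (fun _ => True); split; [apply filter_true; auto|auto]. }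
      apply Hrep; [exact He|]; intros A HA; apply HeF; revert A HA.
      apply (Hmax G); [|exact HFG].
      split; [exact HG|]; intros U V HU HV hU hV A HA.
      destruct (Hrep U HU hU) as (U' & HU' & hU' & ->).
      destruct (Hrep V HV hV) as (V' & HV' & hV' & ->).
      rewrite <- umul_assoc.
      change (umul (umul U' e) V' (fun s => e (fun t => A (s ++ t)))).
      assert (HUe : is_ultra (umul U' e)) by (apply umul_ultra; auto).
      apply (Hsg (umul U' e) V'); auto. }
    destruct Hfac as (U0 & HU0 & hU0 & He0).
    (* This filter represents the closed semigroup of those [U] above [F] that satisfy
       [umul U e = e]; maximality once more puts [e] into it. *)
    pose (G := fun B => forall U, is_ultra U -> (forall A, F A -> U A) -> e = umul U e -> U B).
    assert (HGe : forall V, is_ultra V -> (forall B, G B -> V B) -> (forall A, F A -> V A) /\ e = umul V e).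
    { intros V HV hV; split.
      - intros A HA; apply hV; intros U HU hU _; auto.
      - apply ultra_ext; [exact He|apply umul_ultra; auto|]; intros A HA; apply hV.
        intros U HU hU HUe; rewrite HUe in HA; exact HA. }
    assert (HPG : Pr G).
    { unfold G; split; [split; [|split; [|split]]|].
      - intros U HU _ _; apply filter_true; [apply HU|auto].
      - intros A B HA h U HU hU HUe; exact (filter_sub U A B (proj1 HU) (HA U HU hU HUe) h).
      - intros A B HA HB U HU hU HUe; exact (filter_and U A B (proj1 HU) (HA U HU hU HUe) (HB U HU hU HUe)).
      - intros h; apply (proj2 (proj2 (proj2 (proj1 HU0)))); apply h; auto.
      - intros U V HU HV hU hV A HA.
        destruct (HGe U HU hU) as [hU1 hU2]; destruct (HGe V HV hV) as [hV1 hV2].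
        apply HA; [apply umul_ultra; auto|apply Hsg; auto|].
        rewrite umul_assoc, <- hV2; exact hU2. }
    symmetry; apply (HGe e He); intros B HB; apply HeF; revert B HB; apply (Hmax G HPG).
    intros A HA U HU hU _; auto.
Qed.

End WordUltrafilters.

Lemma push_umul {X Y : Type} (f : X -> Y) U V :
  push (map f) (umul U V) = umul (push (map f) U) (push (map f) V).
Proof.
  apply functional_extensionality; intros A; unfold push, umul; f_equal.
  apply functional_extensionality; intros s; f_equal.
  apply functional_extensionality; intros t; rewrite map_app; reflexivity.
Qed.

Lemma push_push {S T R : Type} (f : S -> T) (g : T -> R) U : push g (push f U) = push (fun s => g (f s)) U.
Proof. reflexivity. Qed.

(** A minimal idempotent [p] of constant words lies above an idempotent [e] in a minimal left ideal of variable words; by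
    minimality [e] evaluates to [p] at every letter, and [z] is a right inverse of [e v] in the group around [e]. *)
Lemma idempotent_with_variable {X Y I : Type} (cst : X -> Y) (ev : I -> Y -> X) (v : Y) :
  (forall i x, ev i (cst x) = x) ->
  exists (p : (list X -> Prop) -> Prop) (z : (list Y -> Prop) -> Prop),
    is_ultra p /\ is_ultra z /\
    (forall i, umul (umul p (principal [ev i v])) (push (map (ev i)) z) = p) /\
    (forall i, umul (push (map (ev i)) z) p = push (map (ev i)) z).
Proof.
  intros Hev.
  assert (Htriv : forall X : Type, left_invariant (fun A : list X -> Prop => forall s, A s)).
  { intros X0; split; [split; [|split; [|split]]|]; auto. intros h; exact (h []). }
  destruct (maximal_left_invariant _ (Htriv X)) as (F & HF & _ & HFmax).
  assert (HFsg : forall U V, is_ultra U -> is_ultra V -> (forall A, F A -> U A) -> (forall A, F A -> V A) ->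
     forall A, F A -> umul U V A).
  { intros U V HU HV _ hV; apply left_invariant_mul; auto. }
  destruct (idempotent_above F (proj1 HF) HFsg) as (p & Hp & HpF & Hpp).
  pose (p' := push (map cst) p).
  assert (Hp' : is_ultra p') by (apply push_ultra; exact Hp).
  assert (Hpp' : umul p' p' = p') by (unfold p'; rewrite <- push_umul, Hpp; reflexivity).
  assert (HG0 : left_invariant (fun A : list Y -> Prop => forall s, p' (fun t => A (s ++ t)))).
  { split; [split; [|split; [|split]]|].
    - intros s; apply filter_true; [apply Hp'|auto].
    - intros A B HA h s; eapply filter_sub; [apply Hp'|apply (HA s)|]; simpl; auto.
    - intros A B HA HB s; apply (filter_and _ _ _ (proj1 Hp') (HA s) (HB s)).
    - intros h; apply (proj2 (proj2 (proj2 (proj1 Hp'))) (h [])).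
    - intros A HA s s'; eapply filter_sub; [apply Hp'|apply (HA (s ++ s'))|]; simpl.
      intros t; rewrite app_assoc; auto. }
  destruct (maximal_left_invariant _ HG0) as (G & HG & HG0G & HGmax).
  assert (HGsg : forall U V, is_ultra U -> is_ultra V -> (forall A, G A -> U A) -> (forall A, G A -> V A) ->
     forall A, G A -> umul U V A).
  { intros U V HU HV _ hV; apply left_invariant_mul; auto. }
  destruct (idempotent_above G (proj1 HG) HGsg) as (e' & He' & He'G & Hee').
  (* The ideal consists of left multiples of [p'], so [e'] absorbs [p'] on the right; multiplying by
     [p'] on the left then yields an idempotent [e] that absorbs [p'] on both sides. *)
  destruct (right_factor p' e' Hp' He') as (V' & HV' & HeV').
  { intros A HA; apply He'G, HG0G, HA. }
  assert (He'p : umul e' p' = e') by (rewrite HeV' at 1; rewrite umul_assoc, Hpp'; auto).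
  pose (e := umul p' e').
  assert (He : is_ultra e) by (apply umul_ultra; auto).
  assert (HeG : forall A, G A -> e A) by (apply left_invariant_mul; auto).
  assert (Hpe : umul p' e = e) by (unfold e; rewrite <- umul_assoc, Hpp'; reflexivity).
  assert (Hep : umul e p' = e) by (unfold e; rewrite umul_assoc, He'p; reflexivity).
  assert (Hee : umul e e = e).
  { unfold e at 1; rewrite umul_assoc; unfold e; rewrite <- (umul_assoc e' p' e'), He'p, Hee'; reflexivity. }
  assert (Hevp : forall i, push (map (ev i)) p' = p).
  { intros i; unfold p'; rewrite push_push; unfold push; apply functional_extensionality; intros A; f_equal.
    apply functional_extensionality; intros s; f_equal; rewrite map_map; rewrite <- (map_id s) at 2.
    apply map_ext; apply Hev. }
  (* The evaluation [g] of [e] is idempotent and absorbs [p] on both sides. Minimality writes [p] as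
     [umul V g], so [umul p g = p], while also [umul p g = g]. *)
  assert (Heve : forall i, push (map (ev i)) e = p).
  { intros i; set (g := push (map (ev i)) e).
    assert (Hg : is_ultra g) by (apply push_ultra; exact He).
    assert (Hgp : umul g p = g) by (unfold g; rewrite <- (Hevp i), <- push_umul, Hep; reflexivity).
    assert (Hpg : umul p g = g) by (unfold g; rewrite <- (Hevp i) at 1; rewrite <- push_umul, Hpe; reflexivity).
    assert (Hgg : umul g g = g) by (unfold g; rewrite <- push_umul, Hee; reflexivity).
    assert (HgF : forall A, F A -> g A) by (rewrite <- Hgp; apply left_invariant_mul; auto).
    destruct (minimal_left_ideal F g p HF HFmax Hg HgF Hp HpF) as (V & HV & HpV).
    rewrite <- Hpg; rewrite HpV at 1; rewrite umul_assoc, Hgg; auto. }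
  pose (vv := @principal (list Y) [v]).
  assert (Hvv : is_ultra vv) by apply principal_ultra.
  (* The one-letter word [[v]] is pushed into the group around [e]. Its inverse [y] there gives
     [umul (umul e vv) y = e], and evaluation turns this identity into the required one for [p]. *)
  pose (x := umul (umul e vv) e).
  assert (Hx : is_ultra x) by (repeat apply umul_ultra; assumption).
  assert (HxG : forall A, G A -> x A) by (apply left_invariant_mul; auto; apply umul_ultra; auto).
  assert (Hex : umul e x = x) by (unfold x; rewrite <- !umul_assoc, Hee; reflexivity).
  destruct (minimal_left_ideal G x e HG HGmax Hx HxG He HeG) as (V1 & HV1 & HeV1).
  pose (y := umul (umul e V1) e).
  assert (Hy : is_ultra y) by (repeat apply umul_ultra; assumption).
  assert (HyG : forall A, G A -> y A) by (apply left_invariant_mul; auto; apply umul_ultra; auto).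
  assert (Hey : umul e y = y) by (unfold y; rewrite <- !umul_assoc, Hee; reflexivity).
  assert (Hye : umul y e = y) by (unfold y; rewrite umul_assoc, Hee; reflexivity).
  assert (Hyx : umul y x = e).
  { unfold y; rewrite umul_assoc, Hex, umul_assoc, <- HeV1, Hee; reflexivity. }
  destruct (minimal_left_ideal G y e HG HGmax Hy HyG He HeG) as (V2 & HV2 & HeV2).
  (* A left inverse [q] of [y] equals [x], since [x = (q y) x = q (y x) = q]. *)
  pose (q := umul (umul e V2) e).
  assert (Hqy : umul q y = e).
  { unfold q; rewrite umul_assoc, Hey, umul_assoc, <- HeV2, Hee; reflexivity. }
  assert (Hqe : umul q e = q) by (unfold q; rewrite umul_assoc, Hee; reflexivity).
  assert (Hxq : x = q).
  { rewrite <- Hex, <- Hqy at 1; rewrite umul_assoc, Hyx, Hqe; reflexivity. }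
  assert (Hxy : umul (umul e vv) y = e).
  { rewrite <- Hey at 1; rewrite <- umul_assoc; fold x; rewrite Hxq; exact Hqy. }
  exists p, y; split; [exact Hp|split; [exact Hy|split]].
  - intros i; rewrite <- (Heve i) at 1.
    change (principal [ev i v]) with (push (map (ev i)) vv).
    rewrite <- !push_umul, Hxy; apply Heve.
  - intros i; rewrite <- (Heve i) at 1; rewrite <- push_umul, Hye; reflexivity.
Qed.

Lemma finite_partition_ultra {S : Type} (U : (S -> Prop) -> Prop) (c : S -> nat) (k : nat) :
  is_ultra U -> (forall s, c s < k) -> exists i, U (fun s => c s = i).
Proof.
  intros HU Hk.
  assert (H : forall m, U (fun s => c s < m) -> exists i, U (fun s => c s = i)).
  { induction m as [|m IH]; intros Hm.
    - exfalso; destruct (filter_ex _ _ (proj1 HU) Hm) as [s hs]; lia.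
    - destruct (proj2 HU (fun s => c s = m)) as [h|h]; [exists m; exact h|apply IH].
      eapply filter_sub; [apply HU|apply (filter_and _ _ _ (proj1 HU) Hm h)|]; simpl; intros s hs; lia. }
  apply (H k), filter_true; [apply HU|exact Hk].
Qed.

(** Letters are vectors indexed by [nat]; a variable word has letters acting coordinatewise, and is left-variable:
    the vector [a] itself is inserted before the evaluated word. *)
Theorem coordinatewise_carlson_simpson (B : Type) (c : list (nat -> B) -> nat) (k : nat) :
  (forall w, c w < k) ->
  exists (good : list (nat -> B) -> list (nat -> B) -> Prop) (i : nat),
    (forall L w, good L w -> c w = i) /\
    (forall L, exists w, good L w) /\
    (forall L L' F, (forall w, In w F -> good L w) ->
       exists u : list (nat -> B -> B), forall w a, In w F -> In a L ->
         good L' (w ++ a :: map (fun f s => f s (a s)) u)).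
Proof.
  intros Hk.
  pose (ev := fun (a : nat -> B) (f : nat -> B -> B) (s : nat) => f s (a s)).
  destruct (idempotent_with_variable (fun (x : nat -> B) (s : nat) (_ : B) => x s) ev (fun (_ : nat) b => b))
    as (p & z & Hp & Hz & Hpz & Hzp).
  { intros a x; reflexivity. }
  destruct (finite_partition_ultra p c k Hp Hk) as [i Hi].
  pose (D := fun w => c w = i).
  (* The ultrafilter of continuations that begin with the letter [a]. From [umul p (r a) = p] good
     words exist; from [umul (r a) (r a') = r a] a good word, once extended, can be extended
     again. *)
  pose (r := fun a : nat -> B => umul (principal [a]) (push (map (ev a)) z)).
  assert (Hr : forall a, is_ultra (r a)).
  { intros a; apply umul_ultra; [apply principal_ultra|apply push_ultra; exact Hz]. }
  assert (Hpr : forall a, umul p (r a) = p) by (intros a; unfold r; rewrite <- umul_assoc; apply Hpz).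
  assert (Hrr : forall a a', umul (r a) (r a') = r a).
  { intros a a'; unfold r at 1; rewrite umul_assoc; unfold r at 2; f_equal.
    rewrite <- (Hzp a) at 1; rewrite umul_assoc, Hpr; apply Hzp. }
  pose (good := fun L w => D w /\ forall a, In a L -> r a (fun t => D (w ++ t))).
  exists good, i; split; [intros L w h; apply h|split].
  - intros L; apply (filter_ex p); [apply Hp|].
    apply filter_and; [apply Hp|exact Hi|].
    apply (filter_forall_in p L (fun a w => r a (fun t => D (w ++ t)))); [apply Hp|].
    intros a _; change (umul p (r a) D); rewrite Hpr; exact Hi.
  - intros L L' F HF.
    (* One [u] serves all pairs of a word in [F] and a letter in [L], because finitely many
       [z]-large sets meet. *)
    assert (Hz1 : z (fun u => forall wa, In wa (list_prod F L) -> good L' (fst wa ++ snd wa :: map (ev (snd wa)) u))).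
    { apply (filter_forall_in z (list_prod F L) (fun wa u => good L' (fst wa ++ snd wa :: map (ev (snd wa)) u)));
        [apply Hz|].
      intros [w a] Hwa; apply in_prod_iff in Hwa; destruct Hwa as [Hw Ha]; simpl.
      change (r a (fun t => good L' (w ++ t))).
      assert (Hwr : r a (fun t => D (w ++ t))) by (apply (HF w Hw); exact Ha).
      apply filter_and; [apply Hr|exact Hwr|].
      apply (filter_forall_in (r a) L' (fun b x => r b (fun t => D ((w ++ x) ++ t)))); [apply Hr|].
      intros b _; rewrite <- (Hrr a b) in Hwr; unfold umul at 1 in Hwr.
      eapply filter_sub; [apply Hr|exact Hwr|]; simpl; intros x hx.
      eapply filter_sub; [apply Hr|exact hx|]; simpl; intros t; rewrite app_assoc; auto. }
    destruct (filter_ex z _ (proj1 Hz) Hz1) as [u Hu].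
    exists u; intros w a Hw Ha; apply (Hu (w, a)); apply in_prod_iff; auto.
Qed.

(** * Nodes and copies *)

(** A node of level [n] carries one row for each level below [n]; rows are themselves nodes.
    The rank, stored at the root, is the number of vertices whose joint type the node describes; rank [0] is
    reserved for rows whose only purpose is to make types branch. *)
Inductive node : Type := Leaf (j c : nat) | Nd (a r : node).

Fixpoint lev (t : node) : nat := match t with Leaf _ _ => 0 | Nd a _ => S (lev a) end.
Fixpoint rk (t : node) : nat := match t with Leaf j _ => j | Nd a _ => rk a end.

Fixpoint ext (t s : node) : Prop :=
  t = s \/ match t with Leaf _ _ => False | Nd a _ => ext a s end.

(** [K j] counts the root labels of rank [j]. The level of a row is only bounded by that of its
    base, because a copy turns the row [r] into [mn f r], which may lie well below the level of the
    image of the base. *)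
Fixpoint wf (K : nat -> nat) (t : node) : Prop :=
  match t with
  | Leaf j c => c < K j
  | Nd a r => wf K a /\ wf K r /\ lev r <= lev a /\ (rk r = S (rk a) \/ rk r = 0)
  end.

(** The least node that [f t] may be when [f] is already known below the level of [t]. *)
Fixpoint mn (f : node -> node) (t : node) : node :=
  match t with Leaf j c => Leaf j c | Nd a r => Nd (f a) (mn f r) end.

Fixpoint row_at (y : nat) (t : node) : node :=
  match t with
  | Leaf _ _ => Leaf 0 0
  | Nd a r => if lev a =? y then r else row_at y a
  end.

Lemma ext_refl t : ext t t.
Proof. destruct t; left; reflexivity. Qed.

Lemma ext_trans t s r : ext t s -> ext s r -> ext t r.
Proof.
  induction t as [j c|a IH b _]; simpl; intros [<-|h] h'; auto; try contradiction.
Qed.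

Lemma ext_Nd a r s : ext a s -> ext (Nd a r) s.
Proof. right; assumption. Qed.

Lemma ext_lev t s : ext t s -> lev s <= lev t.
Proof.
  induction t as [j c|a IH b _]; simpl; intros [<-|h]; simpl; try contradiction; auto.
Qed.

Lemma ext_rk t s : ext t s -> rk t = rk s.
Proof.
  induction t as [j c|a IH b _]; simpl; intros [<-|h]; simpl; try contradiction; auto.
Qed.

Lemma ext_wf K t s : ext t s -> wf K t -> wf K s.
Proof.
  induction t as [j c|a IH b _]; simpl; intros [<-|h]; simpl; try contradiction; auto. tauto.
Qed.

Lemma ext_same_lev t s : ext t s -> lev t = lev s -> t = s.
Proof.
  destruct t as [j c|a b]; simpl; intros [h|h] hl; try contradiction; auto.
  apply ext_lev in h; lia.
Qed.

Lemma ext_Nd_lt a r s : ext (Nd a r) s -> lev s <= lev a -> ext a s.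
Proof. intros [<-|h] hl; [simpl in hl; lia|exact h]. Qed.

Lemma ext_common t s s' : ext t s -> ext t s' -> lev s <= lev s' -> ext s' s.
Proof.
  induction t as [j c|a IH b _]; intros h h' hl.
  - destruct h as [<-|[]]; destruct h' as [<-|[]]; apply ext_refl.
  - destruct h' as [<-|h']; [exact h|].
    apply IH; auto. apply ext_Nd_lt in h; [exact h|]. apply ext_lev in h'; lia.
Qed.

Lemma cut_at t n : n <= lev t -> exists s, ext t s /\ lev s = n.
Proof.
  induction t as [j c|a IH b _]; intros h.
  - exists (Leaf j c); simpl in *; split; [left; reflexivity|lia].
  - destruct (Nat.eq_dec n (S (lev a))) as [->|hn].
    + exists (Nd a b); split; [apply ext_refl|reflexivity].
    + simpl in h; destruct IH as [s [h1 h2]]; [lia|]; exists s; split; [apply ext_Nd; exact h1|exact h2].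
Qed.

Lemma row_at_ext y t s : ext t s -> y < lev s -> row_at y t = row_at y s.
Proof.
  induction t as [j c|a IH b _]; intros [<-|h] hl; auto; try contradiction.
  simpl; destruct (Nat.eqb_spec (lev a) y) as [he|he]; [|auto].
  apply ext_lev in h; lia.
Qed.

(** For [Nd a r], [copy_ext] forces the image to continue [f a] by the row [mn f r]; the rows after
    that are free. [copy_fix] makes infinite compositions converge in the fusion. *)
Record copy (K : nat -> nat) (N : nat) (f : node -> node) : Prop := {
  copy_lev : exists x, forall t, wf K t -> lev (f t) = x (lev t);
  copy_wf : forall t, wf K t -> wf K (f t);
  copy_ext : forall t, wf K t -> ext (f t) (mn f t);
  copy_fix : forall t, wf K t -> lev t < N -> f t = t
}.

Lemma mn_comp f g t : mn (fun s => f (g s)) t = mn f (mn g t).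
Proof. induction t as [j c|a _ r IH]; simpl; [reflexivity|rewrite IH; reflexivity]. Qed.

Lemma mn_id_below f t N K : (forall s, wf K s -> lev s < N -> f s = s) -> wf K t -> lev t <= N -> mn f t = t.
Proof.
  intros Hf; induction t as [j c|a _ r IH]; simpl; [reflexivity|].
  intros (h1 & h2 & h3 & _) hl; rewrite IH, Hf; auto; lia.
Qed.

Lemma copy_id K N : copy K N (fun t => t).
Proof.
  split; auto.
  - exists (fun n => n); auto.
  - intros t h; rewrite (mn_id_below _ t (lev t) K); auto using ext_refl.
Qed.

Lemma copy_weaken K N N' f : N' <= N -> copy K N f -> copy K N' f.
Proof. intros hN [h1 h2 h3 h4]; split; auto; intros t ht hl; apply h4; [exact ht|lia]. Qed.

Section Copy.
Context {K : nat -> nat} {N : nat} {f : node -> node} (Hf : copy K N f).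

Lemma copy_rk t : wf K t -> rk (f t) = rk t.
Proof.
  induction t as [j c|a IH r _]; intros ht; rewrite (ext_rk _ _ (copy_ext _ _ _ Hf _ ht)); simpl; [reflexivity|].
  apply IH, ht.
Qed.

Lemma mn_wf t : wf K t -> wf K (mn f t).
Proof. intros ht; eapply ext_wf; [apply (copy_ext _ _ _ Hf _ ht)|apply (copy_wf _ _ _ Hf _ ht)]. Qed.

Lemma copy_mono t s : wf K t -> ext t s -> ext (f t) (f s).
Proof.
  induction t as [j c|a IH r _]; intros ht [<-|h]; try contradiction; try apply ext_refl.
  eapply ext_trans; [apply (copy_ext _ _ _ Hf _ ht)|]; simpl mn; apply ext_Nd, IH; [apply ht|exact h].
Qed.

Lemma copy_lev_eq t s : wf K t -> wf K s -> lev t = lev s -> lev (f t) = lev (f s).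
Proof. intros ht hs h; destruct (copy_lev _ _ _ Hf) as [x hx]; rewrite !hx, h; auto. Qed.

Lemma copy_lev_lt t s : wf K t -> wf K s -> lev t < lev s -> lev (f t) < lev (f s).
Proof.
  intros ht hs h; destruct s as [j c|a r]; simpl in h; [lia|].
  destruct (cut_at a (lev t)) as [a' [h1 h2]]; [lia|].
  assert (ha : wf K a) by apply hs.
  assert (ha' : wf K a') by (eapply ext_wf; eauto).
  rewrite (copy_lev_eq t a' ht ha' (eq_sym h2)).
  pose proof (ext_lev _ _ (copy_mono _ _ ha h1)).
  pose proof (ext_lev _ _ (copy_ext _ _ _ Hf _ hs)) as h3; simpl in h3; lia.
Qed.

Lemma lev_mn_eq t s : wf K t -> wf K s -> lev t = lev s -> lev (mn f t) = lev (mn f s).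
Proof.
  destruct t as [j c|a r], s as [j' c'|a' r']; simpl; intros ht hs h; try lia.
  f_equal; apply copy_lev_eq; [apply ht|apply hs|lia].
Qed.

(** Strict growth of levels shows that the bases have equal level. Both [mn f a] and [mn f a'] are
    then segments of the common node [f a = f a'] of the same length, so they coincide and induction
    applies. *)
Lemma mn_inj t s : wf K t -> wf K s -> mn f t = mn f s -> t = s.
Proof.
  revert s; induction t as [j c|a IHa r IHr]; intros [j' c'|a' r'] ht hs; simpl; intros h; try discriminate; auto.
  injection h as h1 h2.
  assert (hl : lev a = lev a').
  { destruct (lt_eq_lt_dec (lev a) (lev a')) as [[h'|h']|h']; [|exact h'|];
      apply copy_lev_lt in h'; try apply ht; try apply hs; rewrite h1 in h'; lia. }
  f_equal; [|apply IHr; [apply ht|apply hs|exact h2]].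
  apply IHa; [apply ht|apply hs|].
  apply ext_same_lev; [|apply lev_mn_eq; [apply ht|apply hs|exact hl]].
  apply (ext_common (f a)); [rewrite h1; apply (copy_ext _ _ _ Hf), hs|apply (copy_ext _ _ _ Hf), ht|].
  erewrite lev_mn_eq; [apply le_n|apply hs|apply ht|lia].
Qed.

(** Rows at image levels are images of rows, so relations computed from rows at coded levels survive
    every copy. *)
Lemma row_at_mn x t y :
  (forall s, wf K s -> lev (f s) = x (lev s)) ->
  wf K t -> y < lev t -> row_at (x y) (mn f t) = mn f (row_at y t).
Proof.
  intros hx; induction t as [j c|a IHa r IHr]; simpl; intros ht hy; [lia|].
  assert (ha : wf K a) by apply ht.
  rewrite (hx a ha).
  destruct (Nat.eqb_spec (lev a) y) as [->|hne]; [rewrite Nat.eqb_refl; reflexivity|].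
  destruct (cut_at a y) as [s [h1 h2]]; [lia|].
  assert (hs : wf K s) by (eapply ext_wf; eauto).
  assert (hlt : x y < x (lev a)).
  { rewrite <- (hx a ha), <- h2, <- (hx s hs); apply copy_lev_lt; auto; lia. }
  destruct (Nat.eqb_spec (x (lev a)) (x y)) as [h|_]; [lia|].
  rewrite <- IHa; [|exact ha|lia].
  apply row_at_ext; [apply (copy_ext _ _ _ Hf _ ha)|].
  destruct a as [j c|b r']; [simpl in *; lia|].
  simpl in h1 |- *; destruct h1 as [<-|h1]; [simpl in *; lia|].
  assert (hb : wf K b) by apply ha.
  pose proof (ext_lev _ _ (copy_mono _ _ hb h1)) as h3; rewrite (hx s hs), h2 in h3; lia.
Qed.

Lemma row_at_copy x t y :
  (forall s, wf K s -> lev (f s) = x (lev s)) ->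
  wf K t -> y < lev t -> row_at (x y) (f t) = mn f (row_at y t).
Proof.
  intros hx ht hy; rewrite <- (row_at_mn x t y hx ht hy).
  apply row_at_ext; [apply (copy_ext _ _ _ Hf _ ht)|].
  destruct t as [j c|b r']; [simpl in *; lia|]; simpl.
  destruct (cut_at b y) as [s [h1 h2]]; [simpl in hy; lia|].
  assert (hb : wf K b) by apply ht.
  assert (hs : wf K s) by (eapply ext_wf; eauto).
  pose proof (ext_lev _ _ (copy_mono _ _ hb h1)) as h3; rewrite (hx s hs), h2 in h3; lia.
Qed.

End Copy.

Lemma copy_comp K N f g : copy K N f -> copy K N g -> copy K N (fun t => f (g t)).
Proof.
  intros Hf Hg; split.
  - destruct (copy_lev _ _ _ Hf) as [x hx]; destruct (copy_lev _ _ _ Hg) as [y hy].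
    exists (fun n => x (y n)); intros t ht; rewrite hx, hy; auto; apply (copy_wf _ _ _ Hg _ ht).
  - intros t ht; apply (copy_wf _ _ _ Hf), (copy_wf _ _ _ Hg), ht.
  - intros t ht; rewrite mn_comp.
    eapply ext_trans; [apply (copy_mono Hf); [apply (copy_wf _ _ _ Hg _ ht)|apply (copy_ext _ _ _ Hg _ ht)]|].
    apply (copy_ext _ _ _ Hf), (mn_wf Hg), ht.
  - intros t ht hl; rewrite (copy_fix _ _ _ Hg), (copy_fix _ _ _ Hf); auto.
Qed.

(** * The Halpern-Lauchli theorem *)

(** The recursion is on the level bound, since passing to a row raises the rank but never exceeds
    the level of the base. Ill-formed nodes may occur in the list; it serves to bound the
    well-formed ones. *)
Fixpoint all_nodes (K : nat -> nat) (i j : nat) : list node :=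
  match i with
  | 0 => map (Leaf j) (seq 0 (K j))
  | S i => all_nodes K i j ++
      flat_map (fun a => map (Nd a) (all_nodes K i (S j) ++ all_nodes K i 0)) (all_nodes K i j)
  end.

Lemma all_nodes_mono K i i' j t : i <= i' -> In t (all_nodes K i j) -> In t (all_nodes K i' j).
Proof. induction 1; simpl; auto using in_or_app. Qed.

Lemma all_nodes_spec K t i : wf K t -> lev t <= i -> In t (all_nodes K i (rk t)).
Proof.
  intros ht hi; apply (all_nodes_mono K (lev t) i _ t hi); clear hi i.
  induction t as [j c|a IHa r IHr]; simpl in *.
  - apply in_map, in_seq; lia.
  - destruct ht as (h1 & h2 & h3 & h4); apply in_or_app; right.
    apply in_flat_map; exists a; split; [auto|]; apply in_map, in_or_app.
    assert (hr : In r (all_nodes K (lev a) (rk r))) by (eapply all_nodes_mono; [exact h3|auto]).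
    destruct h4 as [h4|h4]; rewrite h4 in hr; auto.
Qed.

Fixpoint vectors {A : Type} (z : A) (n : nat) (h : nat -> list A) : list (nat -> A) :=
  match n with
  | 0 => [fun _ => z]
  | S n => flat_map (fun v => map (fun x s => if s =? n then x else v s) (h n)) (vectors z n h)
  end.

Lemma vectors_spec {A : Type} (z : A) n h (g : nat -> A) :
  (forall s, s < n -> In (g s) (h s)) ->
  exists v, In v (vectors z n h) /\ forall s, s < n -> v s = g s.
Proof.
  induction n as [|n IH]; intros hg; simpl.
  - exists (fun _ => z); split; [left; reflexivity|lia].
  - destruct IH as [v [h1 h2]]; [intros; apply hg; lia|].
    exists (fun s => if s =? n then g n else v s); split.
    + apply in_flat_map; exists v; split; [exact h1|].
      apply (in_map (fun x s => if s =? n then x else v s)), hg; lia.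
    + intros s hs; destruct (Nat.eqb_spec s n) as [->|hn]; [reflexivity|apply h2; lia].
Qed.

Definition zleaf : node := Leaf 0 0.

Definition legal_row (K : nat -> nat) (t r : node) : Prop :=
  wf K r /\ lev r <= lev t /\ (rk r = S (rk t) \/ rk r = 0).

(** Words supplied by the word theorem have arbitrary nodes as letters. Replacing an illegal row by
    a leaf keeps [grow] inside the well-formed nodes without changing lengths. *)
Definition add_row (K : nat -> nat) (t r : node) : node :=
  Nd t (if excluded_middle_informative (legal_row K t r) then r else zleaf).

Definition grow (K : nat -> nat) (t : node) (l : list node) : node := fold_left (add_row K) l t.

Lemma add_row_legal K t r : legal_row K t r -> add_row K t r = Nd t r.
Proof. intros h; unfold add_row; destruct excluded_middle_informative; tauto. Qed.

Lemma grow_ext K t l : ext (grow K t l) t.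
Proof.
  revert t; induction l as [|r l IH]; intros t; [apply ext_refl|].
  eapply ext_trans; [apply IH|]; apply ext_Nd, ext_refl.
Qed.

Lemma grow_lev K t l : lev (grow K t l) = lev t + length l.
Proof.
  revert t; induction l as [|r l IH]; intros t; simpl; [lia|].
  change (lev (grow K (add_row K t r) l) = lev t + S (length l)); rewrite IH; simpl; lia.
Qed.

Lemma grow_wf K t l : 0 < K 0 -> wf K t -> wf K (grow K t l).
Proof.
  intros hK; revert t; induction l as [|r l IH]; intros t ht; [exact ht|].
  apply IH; simpl; split; [exact ht|].
  destruct excluded_middle_informative as [h|_]; [exact h|]; simpl; split; [exact hK|split; [lia|auto]].
Qed.

Lemma mn_agree K f g t n :
  (forall s, wf K s -> lev s < n -> f s = g s) -> wf K t -> lev t <= n -> mn f t = mn g t.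
Proof.
  intros h; induction t as [j c|a _ r IH]; simpl; [reflexivity|].
  intros (h1 & h2 & h3 & _) hl; rewrite IH, h; auto; lia.
Qed.

Lemma level_function K (f : node -> node) :
  (forall t s, wf K t -> wf K s -> lev t = lev s -> lev (f t) = lev (f s)) ->
  exists x, forall t, wf K t -> lev (f t) = x (lev t).
Proof.
  intros h; exists (fun n => lev (f (choose zleaf (fun s => wf K s /\ lev s = n)))).
  intros t ht.
  destruct (choose_spec zleaf (fun s => wf K s /\ lev s = lev t)) as [h1 h2]; [exists t; auto|].
  apply h; auto.
Qed.

Definition node_base (t : node) : node := match t with Nd a _ => a | _ => t end.
Definition node_row (t : node) : node := match t with Nd _ r => r | _ => t end.

Section HalpernLauchli.
Variables (K : nat -> nat) (N : nat) (Q : list node).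
Hypothesis K0 : 0 < K 0.
Hypothesis HQ : NoDup Q.
Hypothesis HQlev : forall q, In q Q -> wf K q /\ lev q = N.
Variable good : list (nat -> node) -> list (nat -> node) -> Prop.
Hypothesis good_ex : forall L, exists w, good L w.
Hypothesis good_step : forall L L' F, (forall w, In w F -> good L w) ->
  exists u : list (nat -> node -> node), forall w a, In w F -> In a L ->
    good L' (w ++ a :: map (fun f s => f s (a s)) u).

Let d := length Q.
Let q_ (s : nat) : node := nth s Q zleaf.

Definition letters (g : node -> node) (i : nat) : list (nat -> node) :=
  vectors zleaf d (fun s => map (mn g) (all_nodes K i (S (rk (q_ s))) ++ all_nodes K i 0)).

Definition above (t : node) (s : nat) : Prop := s < d /\ ext t (q_ s).

(** Extends [b] by the variable word [u] evaluated at [r], in the coordinate of the member of [Q] below [t]. *)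
Definition segment (t : node) (u : list (nat -> node -> node)) (b r : node) : node :=
  grow K b (if excluded_middle_informative (exists s, above t s)
            then map (fun f => f (choose 0 (above t)) r) u else map (fun _ => zleaf) u).

Record stage_data := { s_map : node -> node; s_words : list (list (nat -> node)); s_letters : list (nat -> node) }.

Definition next_word (s : stage_data) (m : nat) : list (nat -> node -> node) :=
  choose [] (fun u => forall w a, In w (s_words s) -> In a (s_letters s) ->
    good (letters (s_map s) (N + S m)) (w ++ a :: map (fun f s => f s (a s)) u)).

(** A letter has one coordinate for each member of [Q], because the rows chosen above different
    members are independent. [s_words] collects every word arising over [Q] at level [N + m].
    [s_letters] refers to the preceding map because [mn] consults it only strictly below the level
    of the row. *)
Fixpoint stage (m : nat) : stage_data :=
  match m with
  | 0 =>
    let w := choose [] (good (letters (fun t => t) N)) in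
    {| s_map := fun t => if lev t <? N then t else segment t (map (fun (a : nat -> node) s _ => a s) w) t zleaf;
       s_words := [w];
       s_letters := letters (fun t => t) N |}
  | S m =>
    let s := stage m in
    let u := next_word s m in
    {| s_map := fun t => if lev t <=? N + m then s_map s t else
         segment t u (Nd (s_map s (node_base t)) (mn (s_map s) (node_row t))) (mn (s_map s) (node_row t));
       s_words := flat_map (fun w => map (fun a => w ++ a :: map (fun f s => f s (a s)) u) (s_letters s)) (s_words s);
       s_letters := letters (s_map s) (N + S m) |}
  end.

Lemma q_spec s : s < d -> wf K (q_ s) /\ lev (q_ s) = N.
Proof. intros h; apply HQlev, nth_In, h. Qed.

Lemma above_unique t s s' : above t s -> above t s' -> s = s'.
Proof.
  intros [h1 h2] [h3 h4].
  apply (proj1 (NoDup_nth Q zleaf) HQ s s' h1 h3); fold (q_ s) (q_ s').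
  pose proof (proj2 (q_spec s h1)); pose proof (proj2 (q_spec s' h3)).
  apply ext_same_lev; [apply (ext_common t); auto; lia|lia].
Qed.

Lemma segment_above t u b r s : above t s -> segment t u b r = grow K b (map (fun f => f s r) u).
Proof.
  intros h; unfold segment.
  destruct excluded_middle_informative as [h'|h']; [|exfalso; apply h'; exists s; exact h].
  rewrite (above_unique t (choose 0 (above t)) s); [reflexivity|apply choose_spec; exists s; exact h|exact h].
Qed.

Lemma segment_lev t u b r : lev (segment t u b r) = lev b + length u.
Proof. unfold segment; rewrite grow_lev; destruct excluded_middle_informative; rewrite length_map; reflexivity. Qed.

Record stage_inv (m : nat) (s : stage_data) : Prop := {
  inv_good : forall w, In w (s_words s) -> good (s_letters s) w;
  inv_lev : exists x : nat -> nat, (forall t, wf K t -> lev t <= N + m -> lev (s_map s t) = x (lev t)) /\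
                     (forall i j, i < j <= N + m -> x i < x j);
  inv_wf : forall t, wf K t -> lev t <= N + m -> wf K (s_map s t);
  inv_ext : forall t, wf K t -> lev t <= N + m -> ext (s_map s t) (mn (s_map s) t);
  inv_rk : forall t, wf K t -> lev t <= N + m -> rk (s_map s t) = rk t;
  inv_fix : forall t, lev t < N -> s_map s t = t;
  inv_word : forall P : nat -> node,
    (forall i, i < d -> ext (P i) (q_ i) /\ wf K (P i) /\ lev (P i) = N + m) ->
    exists w, In w (s_words s) /\ forall i, i < d -> s_map s (P i) = grow K (q_ i) (map (fun a => a i) w);
  inv_letter : forall r : nat -> node,
    (forall i, i < d -> wf K (r i) /\ lev (r i) <= N + m /\ (rk (r i) = S (rk (q_ i)) \/ rk (r i) = 0)) ->
    exists b, In b (s_letters s) /\ forall i, i < d -> b i = mn (s_map s) (r i)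
}.

Lemma letters_spec g i (r : nat -> node) :
  (forall s, s < d -> wf K (r s) /\ lev (r s) <= i /\ (rk (r s) = S (rk (q_ s)) \/ rk (r s) = 0)) ->
  exists b, In b (letters g i) /\ forall s, s < d -> b s = mn g (r s).
Proof.
  intros h; apply (vectors_spec zleaf d _ (fun s => mn g (r s))).
  intros s hs; destruct (h s hs) as (h1 & h2 & h3); apply in_map, in_or_app.
  pose proof (all_nodes_spec K (r s) i h1 h2) as hin.
  destruct h3 as [h3|h3]; rewrite h3 in hin; auto.
Qed.

Lemma stage_ok m : stage_inv m (stage m).
Proof.
  induction m as [|m IH].
  - simpl; set (w := choose [] (good (letters (fun t => t) N))).
    assert (hw : good (letters (fun t => t) N) w) by (apply choose_spec, good_ex).
    set (g := fun t => _).
    assert (hlow : forall t, lev t < N -> g t = t).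
    { intros t ht; unfold g; apply Nat.ltb_lt in ht; rewrite ht; reflexivity. }
    assert (htop : forall t, lev t = N -> g t = segment t (map (fun (a : nat -> node) s _ => a s) w) t zleaf).
    { intros t ht; unfold g; rewrite ht, Nat.ltb_irrefl; reflexivity. }
    assert (hext : forall t, ext (g t) t).
    { intros t; unfold g; destruct (lev t <? N); [apply ext_refl|apply grow_ext]. }
    assert (hmn : forall t, wf K t -> lev t <= N -> mn g t = t).
    { intros t ht hl; apply (mn_id_below g t N K); auto. }
    split; simpl; try rewrite Nat.add_0_r.
    + intros v [<-|[]]; exact hw.
    + exists (fun n => if n <? N then n else N + length w); split.
      * intros t _ ht; destruct (Nat.ltb_spec (lev t) N) as [h|h]; [rewrite hlow; auto|].
        rewrite htop by lia; rewrite segment_lev, length_map; lia.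
      * intros i j hij; destruct (Nat.ltb_spec i N), (Nat.ltb_spec j N); lia.
    + intros t ht hl; unfold g; destruct (lev t <? N); [exact ht|apply grow_wf; auto].
    + intros t ht hl; rewrite hmn; auto.
    + intros t ht hl; apply ext_rk, hext.
    + exact hlow.
    + intros P hP; exists w; split; [left; reflexivity|]; intros i hi; destruct (hP i hi) as (h1 & h2 & h3).
      rewrite htop by lia; rewrite (segment_above _ _ _ _ i) by (split; auto); rewrite map_map.
      f_equal; apply ext_same_lev; [exact h1|]; rewrite (proj2 (q_spec i hi)); lia.
    + intros r hr; destruct (letters_spec (fun t => t) N r hr) as [b [h1 h2]]; exists b; split; [exact h1|].
      intros i hi; rewrite h2 by exact hi; destruct (hr i hi) as (h3 & h4 & _).
      rewrite hmn, (mn_id_below _ _ N K); auto.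
  - destruct IH as [Hgood [x [Hx Hmono]] Hwf Hext Hrk Hfix Hword Hletter].
    simpl; set (st := stage m) in *; set (h := s_map st) in *.
    set (u := next_word st m).
    assert (hu : forall w a, In w (s_words st) -> In a (s_letters st) ->
      good (letters h (N + S m)) (w ++ a :: map (fun f s => f s (a s)) u)).
    { unfold u, next_word; apply choose_spec, good_step, Hgood. }
    set (g := fun t => _).
    assert (hlow : forall t, lev t <= N + m -> g t = h t).
    { intros t ht; unfold g; apply Nat.leb_le in ht; rewrite ht; reflexivity. }
    assert (htop : forall a r, lev a = N + m ->
      g (Nd a r) = segment (Nd a r) u (Nd (h a) (mn h r)) (mn h r)).
    { intros a r ha; unfold g; simpl lev; rewrite ha.
      destruct (Nat.leb_spec (S (N + m)) (N + m)); [lia|reflexivity]. }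
    assert (hmn : forall t, wf K t -> lev t <= N + S m -> mn g t = mn h t).
    { intros t ht hl; apply (mn_agree K g h t (N + S m)); auto; intros s _ hs; apply hlow; lia. }
    assert (hrk : forall t, wf K t -> lev t <= N + m -> rk (mn h t) = rk t).
    { intros [j c|a r] ht hl; simpl in *; [reflexivity|apply Hrk; [apply ht|lia]]. }
    (* Levels grow strictly under [h], so the image of a row is no higher than the image of its
       base, and [add_row] keeps it unchanged. *)
    assert (hlegal : forall a r, wf K (Nd a r) -> lev a = N + m -> legal_row K (h a) (mn h r)).
    { intros a r (h1 & h2 & h3 & h4) hl; split; [|split].
      - eapply ext_wf; [apply Hext; [exact h2|lia]|apply Hwf; [exact h2|lia]].
      - pose proof (ext_lev _ _ (Hext r h2 ltac:(lia))) as hle; fold h in hle.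
        rewrite (Hx r h2) in hle by lia; rewrite (Hx a h1) by lia.
        destruct (Nat.eq_dec (lev r) (lev a)) as [he|he]; [rewrite he in hle; exact hle|].
        pose proof (Hmono (lev r) (lev a) ltac:(lia)); lia.
      - rewrite hrk by (auto; lia); unfold h; rewrite Hrk by (auto; lia); exact h4. }
    assert (hsplit : forall t, lev t <= N + S m -> lev t <= N + m \/ exists a r, t = Nd a r /\ lev a = N + m).
    { intros [j c|a r] ht; simpl in *; [lia|]. destruct (Nat.eq_dec (lev a) (N + m)); [right; eauto|lia]. }
    assert (hext : forall t, wf K t -> lev t <= N + S m -> ext (g t) (mn g t)).
    { intros t ht hl; rewrite hmn by auto; destruct (hsplit t hl) as [h1|(a & r & -> & h1)].
      - rewrite hlow by exact h1; apply Hext; auto.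
      - rewrite htop by exact h1; apply grow_ext. }
    split; simpl.
    + intros v hv; apply in_flat_map in hv; destruct hv as [w [hw hv]].
      apply in_map_iff in hv; destruct hv as [a [<- ha]]; apply hu; auto.
    + exists (fun n => if n <=? N + m then x n else S (x (N + m)) + length u); split.
      * intros t ht hl; destruct (Nat.leb_spec (lev t) (N + m)) as [h1|h1]; [rewrite hlow; auto|].
        destruct (hsplit t hl) as [h2|(a & r & -> & h2)]; [lia|].
        rewrite htop, segment_lev by exact h2; simpl; unfold h; rewrite Hx, h2; [reflexivity|apply ht|lia].
      * intros i j hij; destruct (Nat.leb_spec i (N + m)), (Nat.leb_spec j (N + m)); try lia.
        -- apply Hmono; lia.
        -- destruct (Nat.eq_dec i (N + m)) as [->|hne]; [lia|].
           pose proof (Hmono i (N + m) ltac:(lia)); lia.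
    + intros t ht hl; destruct (hsplit t hl) as [h1|(a & r & -> & h1)]; [rewrite hlow; auto|].
      rewrite htop by exact h1; apply grow_wf; [exact K0|].
      destruct (hlegal a r ht h1) as (h2 & h3 & h4); simpl; split; [apply Hwf; [apply ht|lia]|auto].
    + exact hext.
    + intros t ht hl; rewrite (ext_rk _ _ (hext t ht hl)), hmn by auto.
      destruct (hsplit t hl) as [h1|(a & r & -> & h1)]; [apply hrk; auto|].
      simpl; apply Hrk; [apply ht|lia].
    + intros t ht; rewrite hlow by lia; apply Hfix, ht.
    + intros P hP.
      assert (hPn : forall i, i < d -> exists a r, P i = Nd a r /\ lev a = N + m).
      { intros i hi; destruct (hP i hi) as (_ & _ & h3).
        destruct (hsplit (P i)) as [h4|h4]; [lia|lia|exact h4]. }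
      destruct (Hword (fun i => node_base (P i))) as [w [hw1 hw2]].
      { intros i hi; destruct (hPn i hi) as (a & r & he & h1); destruct (hP i hi) as (h2 & h3 & _).
        rewrite he in *; simpl; split; [|split; [apply h3|exact h1]].
        apply ext_Nd_lt in h2; [exact h2|]; rewrite (proj2 (q_spec i hi)); lia. }
      destruct (Hletter (fun i => node_row (P i))) as [b [hb1 hb2]].
      { intros i hi; destruct (hPn i hi) as (a & r & he & h1); destruct (hP i hi) as (h2 & h3 & _).
        rewrite he in *; simpl; destruct h3 as (h4 & h5 & h6 & h7).
        split; [exact h5|split; [lia|]]; apply ext_rk in h2; simpl in h2; rewrite <- h2; exact h7. }
      exists (w ++ b :: map (fun f s => f s (b s)) u); split.
      * apply in_flat_map; exists w; split; [exact hw1|].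
        apply (in_map (fun a => w ++ a :: map (fun f s => f s (a s)) u)), hb1.
      * intros i hi; destruct (hPn i hi) as (a & r & he & h1); destruct (hP i hi) as (h2 & h3 & _).
        specialize (hw2 i hi); specialize (hb2 i hi); rewrite he in *; simpl in hw2, hb2.
        rewrite htop by exact h1; rewrite (segment_above _ _ _ _ i) by (split; auto).
        rewrite map_app; simpl map; rewrite map_map; unfold grow at 2; rewrite fold_left_app; simpl fold_left.
        fold (grow K (q_ i) (map (fun a0 => a0 i) w)); rewrite <- hw2, hb2; fold h.
        rewrite add_row_legal by (apply hlegal; auto); reflexivity.
    + intros r hr; destruct (letters_spec h (N + S m) r hr) as [b [h1 h2]]; exists b; split; [exact h1|].
      intros i hi; rewrite h2 by exact hi; destruct (hr i hi) as (h3 & h4 & _); rewrite hmn; auto.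
Qed.

Lemma stage_stable m m' t : m <= m' -> lev t <= N + m -> s_map (stage m') t = s_map (stage m) t.
Proof.
  intros hm hl; induction hm as [|m' hm IH]; [reflexivity|]; rewrite <- IH; simpl.
  destruct (Nat.leb_spec (lev t) (N + m')); [reflexivity|lia].
Qed.

(** The limit of the stages, which agree on low levels; truncated subtraction selects stage 0 below
    level [N]. *)
Definition homogeneous_copy (t : node) : node := s_map (stage (lev t - N)) t.

Lemma homogeneous_copy_stage m t : lev t <= N + m -> homogeneous_copy t = s_map (stage m) t.
Proof. intros h; unfold homogeneous_copy; symmetry; apply stage_stable; lia. Qed.

Lemma homogeneous_copy_copy : copy K N homogeneous_copy.
Proof.
  split.
  - apply level_function; intros t s ht hs hl.
    rewrite !(homogeneous_copy_stage (lev t)) by lia.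
    destruct (inv_lev _ _ (stage_ok (lev t))) as [x [hx _]]; rewrite !hx, hl by (auto; lia); reflexivity.
  - intros t ht; apply (inv_wf _ _ (stage_ok _)); [exact ht|lia].
  - intros t ht; rewrite (homogeneous_copy_stage (lev t)) by lia.
    rewrite (mn_agree K homogeneous_copy (s_map (stage (lev t))) t (lev t)); auto.
    + apply (inv_ext _ _ (stage_ok _)); [exact ht|lia].
    + intros s _ hs; apply homogeneous_copy_stage; lia.
  - intros t _ hl; apply (inv_fix _ _ (stage_ok _)), hl.
Qed.

Lemma homogeneous_copy_word (P : nat -> node) M :
  (forall i, i < d -> ext (P i) (q_ i) /\ wf K (P i) /\ lev (P i) = M) ->
  exists L w, good L w /\ forall i, i < d -> homogeneous_copy (P i) = grow K (q_ i) (map (fun a => a i) w).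
Proof.
  intros hP; pose (m := M - N).
  assert (hM : forall i, i < d -> M = N + m).
  { intros i hi; destruct (hP i hi) as (h1 & _ & h2); apply ext_lev in h1.
    rewrite (proj2 (q_spec i hi)) in h1; unfold m; lia. }
  destruct (inv_word _ _ (stage_ok m) P) as [w [hw1 hw2]].
  - intros i hi; rewrite <- (hM i hi); auto.
  - exists (s_letters (stage m)), w; split; [apply (inv_good _ _ (stage_ok m)), hw1|].
    intros i hi; rewrite <- hw2 by exact hi; apply homogeneous_copy_stage.
    destruct (hP i hi) as (_ & _ & h2); specialize (hM i hi); lia.
Qed.

End HalpernLauchli.

Lemma map_seq_nth {A : Type} (z : A) (l : list A) : l = map (fun s => nth s l z) (seq 0 (length l)).
Proof.
  induction l as [|x l IH]; simpl; [reflexivity|]; f_equal.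
  rewrite <- seq_shift, map_map; exact IH.
Qed.

Lemma Forall2_nth_iff {A B : Type} (R : A -> B -> Prop) (l : list A) (l' : list B) a b :
  Forall2 R l l' -> length l = length l' /\ forall i, i < length l' -> R (nth i l a) (nth i l' b).
Proof.
  induction 1 as [|x y l l' hxy _ [IH1 IH2]]; simpl; [split; [reflexivity|lia]|].
  split; [lia|]; intros [|i] hi; [exact hxy|apply IH2; lia].
Qed.

Definition uniform (K : nat -> nat) (M : nat) (P : list node) : Prop := forall p, In p P -> wf K p /\ lev p = M.

Theorem halpern_lauchli (K : nat -> nat) (N : nat) (Q : list node) (c : list node -> nat) (k : nat) :
  0 < K 0 -> NoDup Q -> uniform K N Q -> (forall l, c l < k) ->
  exists f, copy K N f /\ exists i, forall P M, Forall2 ext P Q -> uniform K M P -> c (map f P) = i.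
Proof.
  intros K0 HQ HQN Hc.
  (* The coordinates of a word are read as rows to be added to the members of [Q]; this turns a
     colouring of tuples of nodes into a colouring of words. *)
  pose (dec := fun (w : list (nat -> node)) =>
    map (fun s => grow K (nth s Q zleaf) (map (fun a => a s) w)) (seq 0 (length Q))).
  destruct (coordinatewise_carlson_simpson node (fun w => c (dec w)) k) as (good & i & Hi & Hex & Hstep);
    [intros; apply Hc|].
  exists (homogeneous_copy K N Q good); split; [apply homogeneous_copy_copy; auto|].
  exists i; intros P M HPQ HP.
  destruct (Forall2_nth_iff _ _ _ zleaf zleaf HPQ) as [hlen hnth].
  destruct (homogeneous_copy_word K N Q K0 HQ HQN good Hex Hstep (fun s => nth s P zleaf) M) as (L & w & hw & hw').
  - intros s hs; split; [apply hnth, hs|apply HP, nth_In; lia].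
  - rewrite <- (Hi L w hw); f_equal; unfold dec.
    rewrite (map_seq_nth zleaf P) at 1; rewrite map_map, hlen.
    apply map_ext_in; intros s hs; apply in_seq in hs; apply hw'; lia.
Qed.

(** * Fusion and the Milliken theorem *)

Section Fusion.
Variables (K : nat -> nat) (A : nat -> (node -> node) -> Prop).
Hypothesis HA : forall n f, copy K 0 f -> exists g, copy K n g /\ A n (fun t => f (g t)).

Let refine (n : nat) (f : node -> node) : node -> node :=
  choose (fun t => t) (fun g => copy K n g /\ A n (fun t => f (g t))).

Fixpoint fuse (n : nat) : node -> node :=
  match n with 0 => fun t => t | S n => fun t => fuse n (refine n (fuse n) t) end.

Lemma fuse_copy n : copy K 0 (fuse n).
Proof.
  induction n as [|n IH]; simpl; [apply copy_id|].
  apply copy_comp; [exact IH|]; apply copy_weaken with n; [lia|].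
  apply (choose_spec (fun t => t) (fun g => copy K n g /\ A n (fun t => fuse n (g t)))), HA, IH.
Qed.

Lemma refine_spec n : copy K n (refine n (fuse n)) /\ A n (fuse (S n)).
Proof.
  apply (choose_spec (fun t => t) (fun g => copy K n g /\ A n (fun t => fuse n (g t)))), HA, fuse_copy.
Qed.

Lemma fuse_tail n m : n <= m -> exists r, copy K n r /\ forall t, fuse m t = fuse n (r t).
Proof.
  induction 1 as [|m hm (r & hr & IH)]; [exists (fun t => t); split; [apply copy_id|auto]|].
  exists (fun t => r (refine m (fuse m) t)); split; [|intros t; apply IH].
  apply copy_comp; [exact hr|]; apply copy_weaken with m; [exact hm|]; apply refine_spec.
Qed.

Lemma fuse_stable n m t : wf K t -> lev t < n -> n <= m -> fuse m t = fuse n t.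
Proof.
  intros ht hl hm; destruct (fuse_tail n m hm) as (r & hr & he); rewrite he.
  rewrite (copy_fix _ _ _ hr); auto.
Qed.

(** [A n] need not pass to the limit, so it is asserted of an approximation [h]. On every bounded
    range of levels [f] is [h] after a copy [r] that fixes all levels up to [n]. *)
Lemma fusion :
  exists f, copy K 0 f /\ forall n, exists h, copy K 0 h /\ A n h /\
    forall m, exists r, copy K (S n) r /\ forall t, wf K t -> lev t <= m -> f t = h (r t).
Proof.
  exists (fun t => fuse (S (lev t)) t).
  assert (hs : forall t m, wf K t -> lev t < m -> fuse (S (lev t)) t = fuse m t).
  { intros t m ht hl; symmetry; apply fuse_stable; auto. }
  split.
  - split.
    + apply level_function; intros t s ht hs' hl; rewrite hl; apply (copy_lev_eq (fuse_copy _)); auto.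
    + intros t ht; apply (copy_wf _ _ _ (fuse_copy _)), ht.
    + intros t ht; rewrite (mn_agree K (fun s => fuse (S (lev s)) s) (fuse (S (lev t))) t (lev t)); auto.
      apply (copy_ext _ _ _ (fuse_copy _)), ht.
    + intros t ht hl; lia.
  - intros n; exists (fuse (S n)); split; [apply fuse_copy|split; [apply refine_spec|]].
    intros m; destruct (fuse_tail (S n) (S n + S m)) as (r & hr & he); [lia|].
    exists r; split; [exact hr|]; intros t ht hl; rewrite <- he; apply hs; [exact ht|lia].
Qed.

End Fusion.

(** A chain of type [ty] (both with the last step first) grows lists of nodes of increasing levels. Each step
    adds to selected members of the last list one row taken from the pool of all earlier starting lists,
    and then extends freely; the first step starts at roots. *)
Notation step_type := (list (nat * nat)).

Definition start (tau : step_type) (C : list (list node)) (pl : list node) : list node :=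
  match C with
  | [] => map (fun p => Leaf (fst p) (snd p)) tau
  | P :: _ => map (fun p => Nd (nth (fst p) P zleaf) (nth (snd p) pl zleaf)) tau
  end.

(** Rows are drawn from starting lists because a copy acts by [mn f] both on rows and on starting
    nodes, but by [f] on members of the chain. The two initial leaves are the possible rows at a
    split level. *)
Fixpoint pool (ty : list step_type) (C : list (list node)) : list node :=
  match ty with
  | [] => [Leaf 0 0; Leaf 0 1]
  | tau :: ty => pool ty (tl C) ++ start tau (tl C) (pool ty (tl C))
  end.

Definition next (tau : step_type) (ty : list step_type) (C : list (list node)) : list node :=
  start tau C (pool ty C).

Definition valid (K : nat -> nat) (tau : step_type) (ty : list step_type) (C : list (list node)) (N : nat) : Prop :=
  NoDup (next tau ty C) /\ uniform K N (next tau ty C) /\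
  match C with [] => True | P :: _ => forall p, In p tau -> fst p < length P end.

Fixpoint chain (K : nat -> nat) (ty : list step_type) (C : list (list node)) (N : nat) : Prop :=
  match ty, C with
  | [], [] => N = 0
  | tau :: ty, P :: C => exists N0 M, chain K ty C N0 /\ valid K tau ty C N0 /\ N0 <= M /\ N = S M /\
      Forall2 ext P (next tau ty C) /\ uniform K M P
  | _, _ => False
  end.

Lemma chain_nodes K ty C N : chain K ty C N -> forall P p, In P C -> In p P -> wf K p /\ lev p < N.
Proof.
  revert C N; induction ty as [|tau ty IH]; intros [|P C] N; simpl; try contradiction.
  intros (N0 & M & h1 & _ & h2 & -> & _ & h3) P' p [<-|hP] hp.
  - destruct (h3 p hp); split; [assumption|lia].
  - destruct (IH C N0 h1 P' p hP hp); split; [assumption|lia].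
Qed.

(** Starting nodes lie one level above the preceding list, and [mn f] moves level [S M] to
    [S (x M)]. *)
Definition shift_level (x : nat -> nat) (N : nat) : nat := match N with 0 => 0 | S M => S (x M) end.

Lemma copy_level_mono K N f x :
  0 < K 0 -> copy K N f -> (forall t, wf K t -> lev (f t) = x (lev t)) -> forall i j, i < j -> x i < x j.
Proof.
  intros K0 hf hx i j hij.
  assert (hn : forall n, wf K (grow K zleaf (repeat zleaf n)) /\ lev (grow K zleaf (repeat zleaf n)) = n).
  { intros n; split; [apply grow_wf; simpl; auto|]; rewrite grow_lev, repeat_length; reflexivity. }
  destruct (hn i) as [h1 h2], (hn j) as [h3 h4].
  pose proof (copy_lev_lt hf _ _ h1 h3) as h; rewrite !hx, h2, h4 in h; auto.
Qed.

Lemma NoDup_map_inj_in {A B : Type} (f : A -> B) (l : list A) :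
  (forall a b, In a l -> In b l -> f a = f b -> a = b) -> NoDup l -> NoDup (map f l).
Proof.
  induction l as [|a l IH]; intros hf hl; simpl; [constructor|].
  inversion hl as [|? ? h1 h2]; subst; constructor.
  - intros h; apply in_map_iff in h; destruct h as [b [hb hin]].
    apply h1; rewrite (hf a b); simpl; auto.
  - apply IH; [intros; apply hf; simpl; auto|exact h2].
Qed.

Lemma Forall2_map2 {A B A' B' : Type} (R : A -> B -> Prop) (R' : A' -> B' -> Prop) f g l l' :
  (forall a b, In a l -> In b l' -> R a b -> R' (f a) (g b)) -> Forall2 R l l' -> Forall2 R' (map f l) (map g l').
Proof.
  intros h H; induction H as [|a b l l' hab _ IH]; simpl; constructor.
  - apply h; simpl; auto.
  - apply IH; intros; apply h; simpl; auto.
Qed.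

Section ChainCopy.
Context {K : nat -> nat} {f : node -> node} {x : nat -> nat}.
Hypotheses (K0 : 0 < K 0) (Hf : copy K 0 f) (Hx : forall t, wf K t -> lev (f t) = x (lev t)).

Lemma uniform_copy M P : uniform K M P -> uniform K (x M) (map f P).
Proof.
  intros h p hp; apply in_map_iff in hp; destruct hp as [q [<- hq]]; destruct (h q hq) as [h1 h2].
  split; [apply (copy_wf _ _ _ Hf _ h1)|rewrite Hx, h2; auto].
Qed.

Lemma start_copy tau C pl :
  match C with [] => True | P :: _ => forall p, In p tau -> fst p < length P end ->
  start tau (map (map f) C) (map (mn f) pl) = map (mn f) (start tau C pl).
Proof.
  destruct C as [|P C]; intros h; simpl; rewrite map_map; apply map_ext_in; [reflexivity|].
  intros p hp; simpl; f_equal.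
  - rewrite nth_indep with (d' := f zleaf) by (rewrite length_map; apply h, hp); apply map_nth.
  - change zleaf with (mn f zleaf) at 1; apply map_nth.
Qed.

Lemma pool_copy ty C N : chain K ty C N -> pool ty (map (map f) C) = map (mn f) (pool ty C).
Proof.
  revert C N; induction ty as [|tau ty IH]; intros [|P C] N; simpl; try contradiction; [reflexivity|].
  intros (N0 & M & h1 & h2 & _); rewrite map_app, (IH _ _ h1); f_equal; apply start_copy, h2.
Qed.

Lemma next_copy tau ty C N : chain K ty C N -> valid K tau ty C N ->
  next tau ty (map (map f) C) = map (mn f) (next tau ty C).
Proof. intros h1 h2; unfold next; rewrite (pool_copy _ _ _ h1); apply start_copy, h2. Qed.

Lemma valid_copy tau ty C N : chain K ty C N -> valid K tau ty C N ->
  valid K tau ty (map (map f) C) (shift_level x N).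
Proof.
  intros h1 h2; unfold valid; rewrite (next_copy _ _ _ _ h1 h2); destruct h2 as (h2 & h3 & h4).
  split; [|split].
  - apply NoDup_map_inj_in; [|exact h2]; intros a b ha hb; apply (mn_inj Hf); apply h3; assumption.
  - intros p hp; apply in_map_iff in hp; destruct hp as [q [<- hq]]; destruct (h3 q hq) as [h5 h6].
    split; [apply (mn_wf Hf _ h5)|]; subst N; destruct q as [j c|a r]; simpl; [reflexivity|].
    rewrite Hx; [reflexivity|apply h5].
  - destruct C as [|P C]; simpl; [exact I|]; rewrite length_map; exact h4.
Qed.

Lemma step_copy tau ty C N P : chain K ty C N -> valid K tau ty C N ->
  (exists M, uniform K M P) -> Forall2 ext P (next tau ty C) ->
  Forall2 ext (map f P) (next tau ty (map (map f) C)).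
Proof.
  intros h1 h2 [M h3] h4; rewrite (next_copy _ _ _ _ h1 h2).
  apply (Forall2_map2 ext); [|exact h4]; intros p q hp hq hpq.
  eapply ext_trans; [apply (copy_mono Hf); [apply h3, hp|exact hpq]|].
  apply (copy_ext _ _ _ Hf), h2, hq.
Qed.

Lemma chain_copy ty C N : chain K ty C N -> chain K ty (map (map f) C) (shift_level x N).
Proof.
  revert C N; induction ty as [|tau ty IH]; intros [|P C] N; simpl; try contradiction; [intros ->; reflexivity|].
  intros (N0 & M & h1 & h2 & h3 & -> & h4 & h5); exists (shift_level x N0), (x M).
  split; [apply IH, h1|split; [apply valid_copy; assumption|split; [|split; [reflexivity|split]]]].
  - destruct N0 as [|N0]; simpl; [lia|]; apply (copy_level_mono K 0 f x K0 Hf Hx); lia.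
  - eapply step_copy; eauto.
  - apply uniform_copy, h5.
Qed.

End ChainCopy.

Fixpoint choices {A : Type} (ls : list (list A)) : list (list A) :=
  match ls with
  | [] => [[]]
  | l :: ls => flat_map (fun a => map (cons a) (choices ls)) l
  end.

Lemma choices_spec {A : Type} (l : list A) ls : Forall2 (@In A) l ls -> In l (choices ls).
Proof.
  induction 1 as [|a m l ls ha _ IH]; simpl; [auto|].
  apply in_flat_map; exists a; split; [exact ha|apply in_map, IH].
Qed.

Lemma finite_union {A : Type} (P : nat -> A -> Prop) (n : nat) :
  (forall i, exists l, forall a, P i a -> In a l) -> exists l, forall i a, i <= n -> P i a -> In a l.
Proof.
  intros h; induction n as [|n [l IH]].
  - destruct (h 0) as [l hl]; exists l; intros i a hi; replace i with 0 by lia; apply hl.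
  - destruct (h (S n)) as [l' hl]; exists (l ++ l'); intros i a hi ha; apply in_or_app.
    destruct (Nat.eq_dec i (S n)) as [->|hne]; [right; auto|left; apply (IH i); [lia|exact ha]].
Qed.

(** Members of a chain lie below level [N] and inherit their ranks from the starting list, which
    leaves finitely many candidates at each step. The fusion can therefore treat all chains at [N]
    one after another. *)
Lemma chains_finite K ty N : exists Cs, forall C, chain K ty C N -> In C Cs.
Proof.
  revert N; induction ty as [|tau ty IH]; intros N.
  - exists [[]]; intros [|P C]; simpl; [auto|contradiction].
  - destruct (finite_union (fun N C => chain K ty C N) N IH) as [Cs hCs].
    exists (flat_map (fun C => map (fun P => P :: C)
      (choices (map (fun q => all_nodes K N (rk q)) (next tau ty C)))) Cs).
    intros [|P C]; simpl; [contradiction|]; intros (N0 & M & h1 & h2 & h3 & -> & h4 & h5).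
    apply in_flat_map; exists C; split; [apply (hCs N0); [lia|exact h1]|].
    apply (in_map (fun P => P :: C)), choices_spec.
    rewrite <- (map_id P); apply (Forall2_map2 ext); [|exact h4]; intros p q hp hq hpq.
    rewrite <- (ext_rk _ _ hpq); destruct (h5 p hp); apply all_nodes_spec; [assumption|lia].
Qed.

Definition extends_to (K : nat -> nat) (P Q : list node) : Prop := Forall2 ext P Q /\ exists M, uniform K M P.

Lemma extends_to_copy K N g P Q : copy K N g -> uniform K N Q -> extends_to K P Q -> extends_to K (map g P) Q.
Proof.
  intros hg hQ [h1 [M h2]]; destruct (copy_lev _ _ _ hg) as [x hx]; split.
  - rewrite <- (map_id Q); apply (Forall2_map2 ext); [|exact h1]; intros p q hp hq hpq.
    destruct (hQ q hq) as [hq1 hq2].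
    eapply ext_trans; [apply (copy_mono hg); [apply h2, hp|exact hpq]|].
    rewrite <- (mn_id_below g q N K) at 2; [apply (copy_ext _ _ _ hg _ hq1)|apply (copy_fix _ _ _ hg)|exact hq1|lia].
  - exists (x M); apply (uniform_copy (copy_weaken K N 0 g (Nat.le_0_l N) hg) hx _ _ h2).
Qed.

Definition end_homogeneous (K : nat -> nat) (tau : step_type) (ty : list step_type)
    (chi : list (list node) -> nat) (f : node -> node) (C : list (list node)) : Prop :=
  forall P P', extends_to K P (next tau ty C) -> extends_to K P' (next tau ty C) ->
    chi (map f P :: map (map f) C) = chi (map f P' :: map (map f) C).

Lemma chain_fixed K ty C N N' g : copy K N' g -> N <= N' -> chain K ty C N -> map (map g) C = C.
Proof.
  intros hg hN hC; rewrite <- (map_id C) at 2; apply map_ext_in; intros P hP.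
  rewrite <- (map_id P) at 2; apply map_ext_in; intros p hp.
  destruct (chain_nodes _ _ _ _ hC P p hP hp); apply (copy_fix _ _ _ hg); [assumption|lia].
Qed.

(** Each chain takes one use of [halpern_lauchli] above its starting list. The new copy fixes the
    levels below [N], hence all these chains, and sends extensions of a starting list to extensions
    of it, so chains treated earlier stay homogeneous. *)
Lemma end_homogeneous_on K tau ty chi k N f Cs :
  0 < K 0 -> (forall C, chi C < k) -> copy K 0 f ->
  exists g, copy K N g /\ forall C, In C Cs -> chain K ty C N -> valid K tau ty C N ->
    end_homogeneous K tau ty chi (fun t => f (g t)) C.
Proof.
  intros K0 hchi hf; induction Cs as [|C Cs (g & hg & IH)].
  - exists (fun t => t); split; [apply copy_id|intros C []].
  - destruct (classic (chain K ty C N /\ valid K tau ty C N)) as [[hC hv]|hno].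
    2:{ exists g; split; [exact hg|]; intros C' [<-|h]; [tauto|auto]. }
    destruct (halpern_lauchli K N (next tau ty C)
      (fun l => chi (map (fun t => f (g t)) l :: map (map (fun t => f (g t))) C)) k K0) as (g' & hg' & i & hi);
      [apply hv|apply hv|auto|].
    exists (fun t => g (g' t)); split; [apply copy_comp; assumption|].
    assert (hmm : forall C', chain K ty C' N ->
      map (map (fun t => f (g (g' t)))) C' = map (map (fun t => f (g t))) C').
    { intros C' hC'; rewrite <- (chain_fixed K ty C' N N g' hg' (le_n N) hC') at 2.
      rewrite map_map; apply map_ext; intros P; rewrite map_map; reflexivity. }
    assert (hm : forall P : list node, map (fun t => f (g (g' t))) P = map (fun t => f (g t)) (map g' P)).
    { intros P; rewrite map_map; reflexivity. }
    intros C' [<-|hin] hC' hv' P P' hP hP'; rewrite (hmm _ hC'), !hm.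
    + destruct hP as [h1 [M h2]], hP' as [h3 [M' h4]]; rewrite (hi P M h1 h2), (hi P' M' h3 h4); reflexivity.
    + apply (IH C' hin hC' hv'); apply (extends_to_copy K N); auto; apply hv'.
Qed.

Theorem milliken (K : nat -> nat) (ty : list step_type) (chi : list (list node) -> nat) (k : nat) :
  0 < K 0 -> (forall C, chi C < k) ->
  exists f, copy K 0 f /\ exists i, forall C N, chain K ty C N -> chi (map (map f) C) = i.
Proof.
  intros K0; revert chi; induction ty as [|tau ty IH]; intros chi hchi.
  - exists (fun t => t); split; [apply copy_id|]; exists (chi []); intros [|P C] N; simpl; [auto|contradiction].
  - destruct (fusion K (fun N f => forall C, chain K ty C N -> valid K tau ty C N ->
                end_homogeneous K tau ty chi f C)) as (f & hf & hhom).
    { intros N f hf; destruct (chains_finite K ty N) as [Cs hCs].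
      destruct (end_homogeneous_on K tau ty chi k N f Cs K0 hchi hf) as (g & hg & h).
      exists g; split; [exact hg|]; intros C hC; apply h; auto. }
    assert (hend : forall C N, chain K ty C N -> valid K tau ty C N -> end_homogeneous K tau ty chi f C).
    { intros C N hC hv P P' hP hP'; destruct (hhom N) as (h & hh & hA & hr).
      (* The factorization of [f] through [h] holds up to a given level only, so a bound for both
         ends is fixed first. *)
      assert (hm : exists m, N <= m /\ forall p, In p (P ++ P') -> wf K p /\ lev p <= m).
      { destruct hP as [_ [M h1]], hP' as [_ [M' h2]]; exists (N + M + M'); split; [lia|].
        intros p hp; apply in_app_or in hp; destruct hp as [hp|hp];
          [destruct (h1 p hp)|destruct (h2 p hp)]; split; try assumption; lia. }
      destruct hm as (m & hNm & hm); destruct (hr m) as (r & hrc & hfr).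
      assert (hC1 : map (map f) C = map (map h) C).
      { rewrite <- (chain_fixed K ty C N (S N) r hrc (Nat.le_succ_diag_r N) hC) at 2.
        rewrite map_map; apply map_ext_in; intros R hR; rewrite map_map; apply map_ext_in; intros p hp.
        destruct (chain_nodes _ _ _ _ hC R p hR hp); apply hfr; [assumption|lia]. }
      assert (hP1 : forall R, (forall p, In p R -> In p (P ++ P')) -> map f R = map h (map r R)).
      { intros R hR; rewrite map_map; apply map_ext_in; intros p hp; apply hfr; apply hm, hR, hp. }
      rewrite hC1, !hP1 by (intros p hp; apply in_or_app; auto).
      apply (copy_weaken K (S N) N) in hrc; [|lia].
      apply hA; auto; apply (extends_to_copy K N); auto; apply hv. }
    (* As the colour no longer depends on the last list, an arbitrary extension [rep C] defines a
       colouring of chains one step shorter. *)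
    pose (rep := fun C => choose [] (fun P => extends_to K P (next tau ty C))).
    destruct (IH (fun C => chi (map f (rep C) :: map (map f) C))) as (g & hg & i & hi); [intros; apply hchi|].
    exists (fun t => f (g t)); split; [apply copy_comp; assumption|]; exists i.
    intros [|P C] N; [intros []|]; intros (N0 & M & h1 & h2 & h3 & -> & h4 & h5).
    destruct (copy_lev _ _ _ hg) as [x hx].
    pose proof (chain_copy K0 hg hx _ _ _ h1) as hC1.
    pose proof (valid_copy hg hx _ _ _ _ h1 h2) as hv1.
    assert (hP1 : extends_to K (map g P) (next tau ty (map (map g) C))).
    { split; [eapply step_copy; eauto|exists (x M); apply (uniform_copy hg hx), h5]. }
    rewrite <- (hi C N0 h1).
    replace (map (map (fun t => f (g t))) (P :: C)) with (map f (map g P) :: map (map f) (map (map g) C)).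
    + apply (hend _ _ hC1 hv1); [exact hP1|]; apply choose_spec; exists (map g P); exact hP1.
    + simpl; rewrite !map_map; f_equal; apply map_ext; intros R; rewrite map_map; reflexivity.
Qed.

(** * Sparse coding of vertices *)

Notation incr := (StronglySorted lt).

Lemma incr_NoDup l : incr l -> NoDup l.
Proof.
  induction 1 as [|a l _ IH h]; constructor; [|exact IH].
  intros hin; rewrite Forall_forall in h; specialize (h a hin); lia.
Qed.

Lemma incr_app_l l l' : incr (l ++ l') -> incr l.
Proof.
  induction l as [|a l IH]; simpl; intros h; [constructor|].
  inversion h as [|? ? h1 h2]; subst; constructor; [auto|].
  apply Forall_app in h2; apply h2.
Qed.

Lemma incr_app_r l l' : incr (l ++ l') -> incr l'.
Proof. induction l as [|a l IH]; simpl; intros h; [exact h|]; inversion h; auto. Qed.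

Lemma incr_lt_last l m a : incr (l ++ [m]) -> In a (l ++ [m]) -> a <= m.
Proof.
  induction l as [|b l IH]; simpl; [intros _ [<-|[]]; lia|].
  intros h [<-|ha]; inversion h as [|? ? h1 h2]; subst; [|auto].
  apply Forall_app in h2; destruct h2 as [_ h2]; inversion h2; lia.
Qed.

Fixpoint bounded_lists {A : Type} (l : list A) (m : nat) : list (list A) :=
  match m with
  | 0 => [[]]
  | S m => [] :: flat_map (fun a => map (cons a) (bounded_lists l m)) l
  end.

Lemma bounded_lists_spec {A : Type} (l k : list A) m : length k <= m -> incl k l -> In k (bounded_lists l m).
Proof.
  revert k; induction m as [|m IH]; intros [|a k] hl hi; simpl in *; auto; try lia.
  right; apply in_flat_map; exists a; split; [apply hi; simpl; auto|].
  apply in_map, IH; [lia|]; intros b hb; apply hi; simpl; auto.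
Qed.

Lemma bounded_lists_incl {A : Type} (l k : list A) m : In k (bounded_lists l m) -> incl k l /\ length k <= m.
Proof.
  revert k; induction m as [|m IH]; intros k; simpl.
  - intros [<-|[]]; split; [intros a []|simpl; lia].
  - intros [<-|h]; [split; [intros a []|simpl; lia]|].
    apply in_flat_map in h; destruct h as (a & ha & h); apply in_map_iff in h; destruct h as (k' & <- & hk).
    destruct (IH k' hk) as [h1 h2]; split; [|simpl; lia].
    intros b [<-|hb]; auto.
Qed.

(** A closed count depending on the length of the list only, so that the final bounds do not mention
    particular vertices. *)
Fixpoint bounded_lists_count (a m : nat) : nat :=
  match m with 0 => 1 | S m => S (a * bounded_lists_count a m) end.

Lemma bounded_lists_length {A : Type} (l : list A) m :
  length (bounded_lists l m) = bounded_lists_count (length l) m.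
Proof.
  induction m as [|m IH]; simpl; [reflexivity|f_equal].
  rewrite (flat_map_constant_length (c := length (bounded_lists l m))); [rewrite IH; lia|].
  intros x _; apply length_map.
Qed.

Lemma in_list_sum x l : In x l -> x <= list_sum l.
Proof. induction l as [|a l IH]; simpl; [intros []|intros [->|h]; [lia|apply IH in h; lia]]. Qed.

Inductive tag : Type := Vertex (u : nat) | Split (S : list nat) (c : nat).

Fixpoint root_label (t : node) : nat := match t with Leaf _ c => c | Nd a _ => root_label a end.

(** Reads the joint code of a list of vertices off the type of the last one, at the (decreasing) levels of the others. *)
Fixpoint read (t : node) (ys : list nat) : nat :=
  match ys with [] => root_label t | y :: ys => read (row_at y t) ys end.

(** The nodes come in increasing order of level. No vertex is consulted, so the value makes sense
    for every tuple of nodes, also outside the coded ones. *)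
Definition read_code (ts : list node) : nat :=
  match rev ts with [] => 0 | t :: ts => read t (map lev ts) end.

Lemma ext_root_label t s : ext t s -> root_label t = root_label s.
Proof. induction t as [j c|a IH r _]; simpl; intros [<-|h]; simpl; try contradiction; auto. Qed.

Lemma copy_root_label K N f t : copy K N f -> wf K t -> root_label (f t) = root_label t.
Proof.
  intros hf; induction t as [j c|a IH r _]; intros ht; rewrite (ext_root_label _ _ (copy_ext _ _ _ hf _ ht)); simpl; [reflexivity|].
  apply IH, ht.
Qed.

Lemma reps_exist {A B : Type} (g : A -> B) (l : list A) :
  exists R, incl R l /\ length R <= length l /\ NoDup (map g R) /\ forall a, In a l -> exists b, In b R /\ g b = g a.
Proof.
  induction l as [|a l (R & h1 & h2 & h3 & h4)].
  - exists []; repeat split; simpl; auto; [intros a []|constructor|intros a []].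
  - destruct (classic (In (g a) (map g R))) as [h|h].
    + exists R; repeat split; simpl; [intros b hb; right; auto|lia|exact h3|].
      intros b [<-|hb]; [|auto]; apply in_map_iff in h; destruct h as (c & hc & hin); exists c; auto.
    + exists (a :: R); repeat split; simpl; [intros b [<-|hb]; simpl; auto|lia|constructor; assumption|].
      intros b [<-|hb]; [exists a; auto|]; destruct (h4 b hb) as (c & hc & he); exists c; auto.
Qed.

Lemma decreasing_exists (l : list nat) :
  exists X, StronglySorted gt X /\ (forall y, In y X <-> In y l) /\ length X <= length l.
Proof.
  assert (ins : forall (a : nat) X, StronglySorted gt X -> exists X', StronglySorted gt X' /\
    (forall y, In y X' <-> y = a \/ In y X) /\ length X' <= S (length X)).
  { intros a X hX; induction hX as [|b X hX (X' & h1 & h2 & h3) hb].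
    - exists [a]; repeat split; simpl; try (repeat constructor); intuition.
    - destruct (lt_eq_lt_dec a b) as [[h|h]|h].
      + exists (b :: X'); split; [|split; [|simpl; lia]].
        * constructor; [exact h1|]; apply Forall_forall; intros y hy; apply h2 in hy.
          rewrite Forall_forall in hb; destruct hy as [->|hy]; [lia|apply hb, hy].
        * intros y; simpl; rewrite h2; intuition.
      + subst b; exists (a :: X); split; [constructor; assumption|split; [|simpl; lia]].
        intros y; simpl; intuition.
      + exists (a :: b :: X); split; [|split; [|simpl; lia]].
        * constructor; [constructor; assumption|]; constructor; [exact h|].
          revert hb; apply Forall_impl; intros; lia.
        * intros y; simpl; intuition. }
  induction l as [|a l (X & h1 & h2 & h3)].
  - exists []; repeat split; simpl; auto; constructor.
  - destruct (ins a X h1) as (X' & h4 & h5 & h6); exists X'; split; [exact h4|split; [|simpl; lia]].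
    intros y; rewrite h5, h2; simpl; intuition.
Qed.

Lemma NoDup_map_finer {A B B' : Type} (g : A -> B) (g' : A -> B') (l : list A) :
  (forall a b, In a l -> In b l -> g' a = g' b -> g a = g b) -> NoDup (map g l) -> NoDup (map g' l).
Proof.
  induction l as [|a l IH]; simpl; intros h hn; [constructor|].
  inversion hn as [|? ? h1 h2]; subst; constructor; [|apply IH; auto].
  intros hin; apply in_map_iff in hin; destruct hin as (b & hb & hin).
  apply h1; rewrite (h a b); auto; apply in_map, hin.
Qed.

Lemma Forall2_choice {A B : Type} (R : A -> B -> Prop) (l : list B) :
  (forall b, In b l -> exists a, R a b) -> exists k, Forall2 R k l.
Proof.
  induction l as [|b l IH]; intros h; [exists []; constructor|].
  destruct (h b) as [a ha]; [simpl; auto|]; destruct IH as [k hk]; [intros; apply h; simpl; auto|].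
  exists (a :: k); constructor; assumption.
Qed.

Lemma Forall2_map_eq {A B D : Type} (f : A -> D) (g : B -> D) k l :
  Forall2 (fun a b => f a = g b) k l -> map f k = map g l.
Proof. induction 1 as [|a b k l h _ IH]; simpl; [reflexivity|rewrite h, IH; reflexivity]. Qed.

Lemma Forall2_in_l {A B : Type} (R : A -> B -> Prop) k l a :
  Forall2 R k l -> In a k -> exists b, In b l /\ R a b.
Proof.
  induction 1 as [|x b k l h _ IH]; simpl; [intros []|].
  intros [<-|ha]; [exists b; auto|destruct (IH ha) as (c & h1 & h2); exists c; auto].
Qed.

Section Coding.
Variables (K : nat -> nat) (code : list nat -> nat) (n : nat).

(** Exceeds every code of a concatenation of at most [u + 1] tested vertices with at most [n]
    further ones. *)
Let label_bound (u : nat) : nat := list_sum (map K (seq 0 (S (S u + n)))).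

(** Before the level of vertex [u] there is, for every [S] below [u] and every possible code [c], a level at which
    types branch according to whether [S] has code [c] with the vertices described by the type. *)
Definition splits (u : nat) : list tag :=
  map (fun p => Split (fst p) (snd p))
    (list_prod (bounded_lists (seq 0 (S u)) (S u)) (seq 0 (label_bound u))).

Fixpoint schedule (u : nat) : list tag :=
  match u with 0 => [] | S u => schedule u ++ splits u ++ [Vertex u] end.

Definition tag_at (y : nat) : tag := nth y (schedule (S y)) (Vertex 0).

Definition vlevel (u : nat) : nat := length (schedule u) + length (splits u).

Lemma schedule_length u : u <= length (schedule u).
Proof. induction u as [|u IH]; simpl; [lia|]; rewrite !length_app; simpl; lia. Qed.

Lemma schedule_length_mono u u' : u <= u' -> length (schedule u) <= length (schedule u').
Proof. induction 1 as [|u' h IH]; [lia|]; simpl; rewrite length_app; lia. Qed.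

Lemma schedule_nth u u' y : u <= u' -> y < length (schedule u) ->
  nth y (schedule u') (Vertex 0) = nth y (schedule u) (Vertex 0).
Proof.
  induction 1 as [|u' h IH]; intros hy; [reflexivity|]; simpl.
  rewrite app_nth1; [auto|]; pose proof (schedule_length_mono u u' h); lia.
Qed.

Lemma tag_at_nth u y : y < length (schedule u) -> tag_at y = nth y (schedule u) (Vertex 0).
Proof.
  intros hy; unfold tag_at; pose proof (schedule_length (S y)).
  destruct (Nat.le_ge_cases u (S y)) as [h|h]; [apply schedule_nth; assumption|].
  symmetry; apply schedule_nth; [exact h|lia].
Qed.

Lemma vlevel_lt_schedule u : vlevel u < length (schedule (S u)).
Proof. unfold vlevel; simpl; rewrite !length_app; simpl; lia. Qed.

Lemma tag_at_vlevel u : tag_at (vlevel u) = Vertex u.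
Proof.
  rewrite (tag_at_nth (S u)) by apply vlevel_lt_schedule; simpl; unfold vlevel.
  rewrite app_nth2 by lia; rewrite app_nth2 by lia.
  replace (length (schedule u) + length (splits u) - length (schedule u) - length (splits u)) with 0 by lia.
  reflexivity.
Qed.

Lemma nth_splits u i : i < length (splits u) -> exists S c, nth i (splits u) (Vertex 0) = Split S c.
Proof.
  intros hi; pose proof (nth_In (splits u) (Vertex 0) hi) as h; unfold splits at 2 in h.
  apply in_map_iff in h; destruct h as (p & hp & _); exists (fst p), (snd p); auto.
Qed.

Lemma schedule_Vertex w y u :
  y < length (schedule w) -> nth y (schedule w) (Vertex 0) = Vertex u -> y = vlevel u.
Proof.
  induction w as [|w IH]; simpl; [lia|]; intros h h'.
  destruct (le_lt_dec (length (schedule w)) y) as [h1|h1].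
  - rewrite app_nth2 in h' by exact h1.
    destruct (le_lt_dec (length (splits w)) (y - length (schedule w))) as [h2|h2].
    + rewrite app_nth2 in h' by exact h2; rewrite !length_app in h; simpl in h.
      replace (y - length (schedule w) - length (splits w)) with 0 in h' by lia.
      injection h' as <-; unfold vlevel; lia.
    + rewrite app_nth1 in h' by exact h2; destruct (nth_splits w _ h2) as (S & c & e); congruence.
  - rewrite app_nth1 in h' by exact h1; auto.
Qed.

Lemma tag_at_Vertex y u : tag_at y = Vertex u -> y = vlevel u.
Proof. apply schedule_Vertex; pose proof (schedule_length (S y)); lia. Qed.

Lemma tag_at_splits u i : i < length (splits u) ->
  tag_at (length (schedule u) + i) = nth i (splits u) (Vertex 0).
Proof.
  intros hi; rewrite (tag_at_nth (S u)) by (simpl; rewrite !length_app; lia); simpl.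
  rewrite app_nth2 by lia; rewrite app_nth1 by lia; f_equal; lia.
Qed.

Lemma split_level u S c : length S <= Datatypes.S u -> (forall s, In s S -> s <= u) -> c < label_bound u ->
  exists y, y < vlevel u /\ tag_at y = Split S c.
Proof.
  intros h1 h2 h3.
  assert (hin : In (Split S c) (splits u)).
  { apply (in_map (fun p => Split (fst p) (snd p)) _ (S, c)), in_prod_iff; split; [|apply in_seq; lia].
    apply bounded_lists_spec; [exact h1|]; intros s hs; apply in_seq; specialize (h2 s hs); lia. }
  destruct (In_nth _ _ (Vertex 0) hin) as (i & hi & he).
  exists (length (schedule u) + i); split; [unfold vlevel; lia|]; rewrite tag_at_splits; assumption.
Qed.

Lemma label_bound_le u j : j <= S u + n -> K j <= label_bound u.
Proof. intros h; apply in_list_sum, in_map, in_seq; lia. Qed.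

Lemma vlevel_mono u u' : u < u' -> vlevel u < vlevel u'.
Proof.
  intros h; apply Nat.lt_le_trans with (length (schedule (S u))); [apply vlevel_lt_schedule|].
  pose proof (schedule_length_mono (S u) u' h); unfold vlevel; lia.
Qed.

Lemma vlevel_lt_inv u u' : vlevel u < vlevel u' -> u < u'.
Proof.
  intros h; destruct (lt_eq_lt_dec u u') as [[h'| ->]|h']; [exact h'|lia|].
  apply vlevel_mono in h'; lia.
Qed.

Lemma vlevel_ge u : u <= vlevel u.
Proof. pose proof (schedule_length u); unfold vlevel; lia. Qed.

Hypothesis K0 : 2 <= K 0.
Hypothesis code_lt : forall L, code L < K (length L).
Hypothesis code_incr : forall L, ~ incr L -> code L = 0.

(** Marking this level too makes the starting list before [vlevel u] have level exactly [vlevel u],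
    which is the level of the rows occurring there. *)
Lemma pre_vlevel u : 1 <= vlevel u /\ exists S c, tag_at (vlevel u - 1) = Split S c.
Proof.
  assert (h : 0 < length (splits u)).
  { destruct (split_level u [] 0) as (y & hy & ht); simpl; [lia|intros s []| |].
    - pose proof (label_bound_le u 0); lia.
    - destruct (splits u) eqn:e; simpl; [|lia]; exfalso.
      unfold splits in e; apply map_eq_nil in e.
      pose proof (label_bound_le u 0) as hb.
      assert (hin : In ([], 0) (list_prod (bounded_lists (seq 0 (S u)) (S u)) (seq 0 (label_bound u)))).
      { apply in_prod_iff; split; [simpl; auto|apply in_seq; lia]. }
      rewrite e in hin; exact hin. }
  split; [unfold vlevel; lia|].
  destruct (nth_splits u (length (splits u) - 1)) as (S & c & e); [lia|].
  exists S, c; rewrite <- e, <- tag_at_splits by lia; f_equal; unfold vlevel; lia.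
Qed.

Fixpoint type_node (y : nat) (W : list nat) : node :=
  match y with
  | 0 => Leaf (length W) (code W)
  | S y => Nd (type_node y W)
      match tag_at y with
      | Vertex u => type_node y (u :: W)
      | Split T c => Leaf 0 (if code (T ++ W) =? c then 1 else 0)
      end
  end.

Definition type_row (y : nat) (W : list nat) : node := node_row (type_node (S y) W).

Definition vertex_node (v : nat) : node := type_node (vlevel v) [v].

Lemma type_node_S y W : type_node (S y) W = Nd (type_node y W) (type_row y W).
Proof. reflexivity. Qed.

Lemma type_row_Vertex u W : type_row (vlevel u) W = type_node (vlevel u) (u :: W).
Proof. unfold type_row; simpl; rewrite tag_at_vlevel; reflexivity. Qed.

Lemma type_node_lev y W : lev (type_node y W) = y.
Proof. induction y as [|y IH]; simpl; [reflexivity|rewrite IH; reflexivity]. Qed.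

Lemma type_node_rk y W : rk (type_node y W) = length W.
Proof. induction y as [|y IH]; simpl; [reflexivity|exact IH]. Qed.

Lemma type_node_wf y W : wf K (type_node y W).
Proof.
  revert W; induction y as [|y IH]; intros W; simpl; [apply code_lt|].
  rewrite type_node_lev, type_node_rk; split; [apply IH|]; destruct (tag_at y) as [u|S c].
  - rewrite type_node_lev, type_node_rk; split; [apply IH|split; [lia|left; reflexivity]].
  - simpl; split; [destruct (code (S ++ W) =? c); lia|split; [lia|auto]].
Qed.

Lemma type_node_ext x y W : x <= y -> ext (type_node y W) (type_node x W).
Proof. induction 1 as [|y h IH]; [apply ext_refl|]; rewrite type_node_S; apply ext_Nd, IH. Qed.

Lemma type_node_root y W : root_label (type_node y W) = code W.
Proof. induction y as [|y IH]; simpl; auto. Qed.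

Lemma type_row_at x y W : y < x -> row_at y (type_node x W) = type_row y W.
Proof.
  intros h; rewrite (row_at_ext _ _ (type_node (S y) W)).
  - rewrite type_node_S; simpl row_at; rewrite type_node_lev, Nat.eqb_refl; reflexivity.
  - apply type_node_ext, h.
  - rewrite type_node_lev; lia.
Qed.

Lemma type_node_restrict x y W W' : x <= y -> type_node y W = type_node y W' -> type_node x W = type_node x W'.
Proof.
  intros h e; assert (h1 := type_node_ext x y W h); rewrite e in h1.
  apply ext_same_lev; [|rewrite !type_node_lev; reflexivity].
  apply (ext_common (type_node y W')); [apply type_node_ext, h|exact h1|rewrite !type_node_lev; lia].
Qed.

Lemma type_node_eq_of_codes y W W' : length W = length W' ->
  (forall S, code (S ++ W) = code (S ++ W')) -> type_node y W = type_node y W'.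
Proof.
  revert W W'; induction y as [|y IH]; intros W W' hl h; simpl.
  - rewrite hl; f_equal; apply (h []).
  - f_equal; [auto|]; destruct (tag_at y) as [u|S c].
    + apply IH; [simpl; congruence|]; intros S.
      change (code (S ++ [u] ++ W) = code (S ++ [u] ++ W')); rewrite !app_assoc; apply h.
    + rewrite h; reflexivity.
Qed.

(** A difference between codes that involve [u] has already made the types branch at a split level below [u]. *)
Lemma no_branching_at_vertices u W W' :
  incr (u :: W) -> incr (u :: W') -> length W = length W' -> length W <= n ->
  type_node (vlevel u) W = type_node (vlevel u) W' ->
  forall y, type_node y (u :: W) = type_node y (u :: W').
Proof.
  intros hW hW' hlen hn heq y.
  assert (hS : forall S, length S <= Datatypes.S u -> (forall s, In s S -> s <= u) -> code (S ++ W) = code (S ++ W')).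
  { intros S h1 h2.
    assert (hc : code (S ++ W) < label_bound u).
    { eapply Nat.lt_le_trans; [apply code_lt|]; apply label_bound_le; rewrite length_app; lia. }
    (* Below [vlevel u] there is a level whose row is the bit telling whether [S] has this very code
       with the list; equal types have equal bits. *)
    destruct (split_level u S (code (S ++ W)) h1 h2 hc) as (z & hz & ht).
    assert (hr : type_row z W = type_row z W').
    { rewrite <- (type_row_at (vlevel u) z W hz), <- (type_row_at (vlevel u) z W' hz), heq; reflexivity. }
    unfold type_row in hr; simpl in hr; rewrite ht, Nat.eqb_refl in hr.
    destruct (Nat.eqb_spec (code (S ++ W')) (code (S ++ W))) as [e|e]; [auto|discriminate]. }
  apply type_node_eq_of_codes; [simpl; congruence|]; intros S.
  (* If [S ++ [u]] is increasing, it has at most [u + 1] members, all at most [u], and is among the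
     tested lists; otherwise both codes are 0. *)
  destruct (classic (incr (S ++ [u]))) as [h|h].
  - change (code (S ++ [u] ++ W) = code (S ++ [u] ++ W')); rewrite !app_assoc; apply hS.
    + apply (Nat.le_trans _ (length (seq 0 (Datatypes.S u)))); [|rewrite length_seq; lia].
      apply NoDup_incl_length; [apply incr_NoDup, h|].
      intros s hs; apply in_seq; pose proof (incr_lt_last _ _ _ h hs); lia.
    + intros s hs; apply (incr_lt_last _ _ _ h hs).
  - rewrite !code_incr; [reflexivity| |].
    + intros h'; apply h, (incr_app_l _ W'); rewrite <- app_assoc; exact h'.
    + intros h'; apply h, (incr_app_l _ W); rewrite <- app_assoc; exact h'.
Qed.

(** [w :: W] has already been joined and [U] is consumed from its largest vertex down: the row at
    [vlevel u] is the type with [u] joined in front, and [mn f] commutes with reading rows. *)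
Lemma read_mn f x U w W : copy K 0 f -> (forall t, wf K t -> lev (f t) = x (lev t)) -> incr (rev U ++ w :: W) ->
  read (mn f (type_node (vlevel w) (w :: W))) (map (fun u => x (vlevel u)) U) = code (rev U ++ w :: W).
Proof.
  intros hf hx; revert w W; induction U as [|u U IH]; intros w W h; simpl in *.
  - rewrite <- (ext_root_label _ _ (copy_ext _ _ _ hf _ (type_node_wf _ _))).
    rewrite (copy_root_label _ _ _ _ hf (type_node_wf _ _)); apply type_node_root.
  - rewrite <- app_assoc in *; simpl in h.
    assert (huw : u < w).
    { apply incr_app_r in h; inversion h as [|? ? _ h2]; inversion h2; assumption. }
    apply vlevel_mono in huw.
    rewrite (row_at_mn hf) by (try apply type_node_wf; try rewrite type_node_lev; auto).
    rewrite type_row_at by exact huw; rewrite type_row_Vertex; apply IH, h.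
Qed.

Lemma read_code_copy f U w : copy K 0 f -> incr (U ++ [w]) ->
  read_code (map (fun v => f (vertex_node v)) (U ++ [w])) = code (U ++ [w]).
Proof.
  intros hf hL; destruct (copy_lev _ _ _ hf) as [x hx]; unfold read_code; rewrite <- map_rev, rev_app_distr.
  simpl; rewrite map_map.
  rewrite (map_ext _ (fun u => x (vlevel u))).
  2:{ intros u; rewrite hx by apply type_node_wf; unfold vertex_node; rewrite type_node_lev; reflexivity. }
  rewrite <- (rev_involutive U) in hL |- * at 2.
  rewrite <- (read_mn f x (rev U) w [] hf hx hL); fold (vertex_node w).
  destruct (rev U) as [|u U']; simpl.
  - apply ext_root_label, (copy_ext _ _ _ hf), type_node_wf.
  - simpl in hL; rewrite <- app_assoc in hL; apply incr_app_r in hL; inversion hL as [|? ? _ h2]; subst.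
    inversion h2 as [|? ? h3 _]; subst; apply vlevel_mono in h3.
    rewrite (row_at_copy hf), (row_at_mn hf); auto; unfold vertex_node; try apply type_node_wf; rewrite type_node_lev; auto.
Qed.


(** * Envelopes of finite sets of vertices *)

Let subset_count : nat := bounded_lists_count n n.
(** Levels of the [n] vertices, the levels just below them, and one branching level for each pair of
    subsets. *)
Let level_count : nat := n + n + subset_count * subset_count.
(** A common bound for ranks, root labels, positions in lists and pools, and lengths of chains. *)
Let index_bound : nat :=
  S n + list_sum (map K (seq 0 (S n))) + S (S (S level_count * subset_count)) + level_count.

Lemma index_bound_spec : n < index_bound /\ list_sum (map K (seq 0 (S n))) < index_bound /\
  2 + level_count * subset_count < index_bound /\ level_count < index_bound /\ subset_count < index_bound.
Proof.
  unfold index_bound; generalize (list_sum (map K (seq 0 (S n)))); intros m.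
  rewrite Nat.mul_succ_l; generalize (level_count * subset_count); intros; lia.
Qed.

Let index_pairs : list (nat * nat) := list_prod (seq 0 index_bound) (seq 0 index_bound).

(** The length of this list is the bound eventually given for the big Ramsey degree. *)
Definition envelope_types : list (list step_type * list (nat * nat)) :=
  list_prod (bounded_lists (bounded_lists index_pairs index_bound) index_bound)
    (bounded_lists index_pairs index_bound).

Section Envelope.
Variable V : list nat.
Hypothesis HVn : length V = n.

Let top (W : list nat) : nat := vlevel (hd 0 W).

Definition subsets : list (list nat) :=
  filter (fun W => if excluded_middle_informative (incr W /\ W <> []) then true else false) (bounded_lists V n).

Lemma in_subsets W : In W subsets <-> incr W /\ W <> [] /\ incl W V.
Proof.
  unfold subsets; rewrite filter_In; destruct (excluded_middle_informative (incr W /\ W <> [])) as [h|h]; split.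
  - intros [h1 _]; apply bounded_lists_incl in h1; tauto.
  - intros (h1 & h2 & h3); split; [|reflexivity]; apply bounded_lists_spec; [|exact h3].
    rewrite <- HVn; apply NoDup_incl_length; [apply incr_NoDup, h1|exact h3].
  - intros [_ h']; discriminate.
  - tauto.
Qed.

Lemma subsets_length : length subsets <= subset_count.
Proof.
  unfold subsets; etransitivity; [apply filter_length_le|]; rewrite bounded_lists_length, HVn; apply le_n.
Qed.

Lemma subset_length W : In W subsets -> length W <= n.
Proof.
  intros h; apply in_subsets in h; rewrite <- HVn; apply NoDup_incl_length; [apply incr_NoDup|]; apply h.
Qed.

Definition branches (W W' : list nat) (y : nat) : Prop :=
  y < top W /\ y < top W' /\ type_node y W = type_node y W' /\ type_node (S y) W <> type_node (S y) W'.

(** The default is the level of a vertex of [V] when [W] is among [subsets], so a pair that does not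
    branch marks no new level. *)
Definition branch (W W' : list nat) : nat :=
  if excluded_middle_informative (exists y, branches W W' y) then choose 0 (branches W W') else top W.

Definition marked : list nat :=
  map vlevel V ++ map (fun v => vlevel v - 1) V ++
  map (fun p => branch (fst p) (snd p)) (list_prod subsets subsets).

Lemma marked_length : length marked <= level_count.
Proof.
  unfold marked; rewrite !length_app, !length_map, length_prod, HVn.
  pose proof subsets_length; unfold level_count; nia.
Qed.

Lemma top_in W : In W subsets -> In (hd 0 W) V.
Proof.
  intros h; apply in_subsets in h; destruct h as (_ & h1 & h2).
  destruct W as [|w W]; [contradiction|]; apply h2; simpl; auto.
Qed.

Lemma incr_cons_subset u W : In W subsets -> u < hd 0 W -> incr (u :: W).
Proof.
  intros h hu; apply in_subsets in h; destruct h as (h1 & h2 & _); constructor; [exact h1|].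
  destruct W as [|w W]; [contradiction|]; simpl in hu; inversion h1 as [|? ? _ h3]; subst.
  constructor; [exact hu|]; revert h3; apply Forall_impl; intros; lia.
Qed.

(** By [no_branching_at_vertices], a branching level is never a vertex level, and a level just below
    a vertex is a split level. So the rows at a marked vertex level only join vertices of [V]. *)
Lemma marked_vertex y u : In y marked -> tag_at y = Vertex u -> In u V.
Proof.
  intros hy ht; unfold marked in hy; apply in_app_or in hy; destruct hy as [hy|hy].
  { apply in_map_iff in hy; destruct hy as (v & <- & hv); rewrite tag_at_vlevel in ht; injection ht as <-; exact hv. }
  apply in_app_or in hy; destruct hy as [hy|hy].
  { apply in_map_iff in hy; destruct hy as (v & <- & hv).
    destruct (pre_vlevel v) as (_ & T & c & e); congruence. }
  apply in_map_iff in hy; destruct hy as ([W W'] & <- & hW); apply in_prod_iff in hW; destruct hW as [hW hW'].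
  simpl in ht; unfold branch in ht; destruct excluded_middle_informative as [hex|hno].
  - apply (choose_spec 0) in hex; destruct hex as (h1 & h2 & h3 & h4).
    exfalso; apply h4; rewrite !type_node_S; f_equal; [exact h3|].
    apply tag_at_Vertex in ht; rewrite ht in *; rewrite !type_row_Vertex.
    apply vlevel_lt_inv in h1, h2.
    apply no_branching_at_vertices; try (apply incr_cons_subset; assumption); auto.
    + apply (f_equal rk) in h3; rewrite !type_node_rk in h3; exact h3.
    + apply subset_length, hW.
  - unfold top in ht; rewrite tag_at_vlevel in ht; injection ht as <-; apply top_in, hW.
Qed.

(** Two types separate at most once, and a separation below both tops takes place at a marked
    level. *)
Lemma agree_between_marked W W' b y : In W subsets -> In W' subsets -> b <= y -> y <= top W -> y <= top W' ->
  (forall z, b <= z < y -> ~ In z marked) ->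
  type_node b W = type_node b W' -> type_node y W = type_node y W'.
Proof.
  intros hW hW' hby h1 h2 hm hb; apply NNPP; intros hne.
  assert (hz : exists z, b <= z < y /\ type_node z W = type_node z W' /\ type_node (S z) W <> type_node (S z) W').
  { clear h1 h2 hm; induction hby as [|y hby IH]; [contradiction|].
    destruct (classic (type_node y W = type_node y W')) as [h|h]; [exists y; split; [lia|auto]|].
    destruct (IH h) as (z & h3 & h4); exists z; split; [lia|exact h4]. }
  destruct hz as (z & hz & h3 & h4).
  assert (hbr : branches W W' (branch W W')).
  { unfold branch; destruct excluded_middle_informative as [hex|hno]; [apply choose_spec, hex|].
    exfalso; apply hno; exists z; repeat split; auto; lia. }
  apply (hm (branch W W')).
  - destruct hbr as (_ & _ & h5 & h6); split.
    + destruct (le_lt_dec b (branch W W')) as [h|h]; [exact h|exfalso; apply h6].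
      apply (type_node_restrict _ b); auto.
    + destruct (le_lt_dec (S z) (branch W W')) as [h|h]; [exfalso; apply h4|lia].
      apply (type_node_restrict _ (branch W W')); auto.
  - unfold marked; apply in_or_app; right; apply in_or_app; right.
    apply (in_map (fun p => branch (fst p) (snd p)) _ (W, W')), in_prod_iff; auto.
Qed.

Let alive (y : nat) : list (list nat) := filter (fun W => y <=? top W) subsets.

(** Several subsets may share a type at level [y], whereas starting lists must be free of
    repetition; one subset is kept for each type. *)
Definition reps (y : nat) : list (list nat) :=
  choose [] (fun R => incl R (alive y) /\ length R <= length (alive y) /\ NoDup (map (type_node y) R) /\
    forall W, In W (alive y) -> exists W', In W' R /\ type_node y W' = type_node y W).

Definition layer (y : nat) : list node := map (type_node y) (reps y).

Lemma reps_spec y :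
  (forall W, In W (reps y) -> In W subsets /\ y <= top W) /\ length (reps y) <= subset_count /\ NoDup (layer y) /\
  forall W, In W subsets -> y <= top W -> In (type_node y W) (layer y).
Proof.
  assert (ha : forall W, In W (alive y) <-> In W subsets /\ y <= top W).
  { intros W; unfold alive; rewrite filter_In, Nat.leb_le; tauto. }
  assert (h : incl (reps y) (alive y) /\ length (reps y) <= length (alive y) /\ NoDup (layer y) /\
    forall W, In W (alive y) -> exists W', In W' (reps y) /\ type_node y W' = type_node y W).
  { exact (choose_spec [] (fun R => incl R (alive y) /\ length R <= length (alive y) /\
      NoDup (map (type_node y) R) /\
      forall W, In W (alive y) -> exists W', In W' R /\ type_node y W' = type_node y W) (reps_exist _ _)). }
  destruct h as (h1 & h2 & h3 & h4); split; [|split; [|split]].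
  - intros W hW; apply ha, h1, hW.
  - etransitivity; [exact h2|]; etransitivity; [apply filter_length_le|apply subsets_length].
  - exact h3.
  - intros W hW hy; destruct (h4 W) as (W' & h5 & h6); [apply ha; auto|].
    rewrite <- h6; apply in_map, h5.
Qed.

Let next_level (X : list nat) : nat := match X with [] => 0 | y :: _ => S y end.

Lemma pool_leaf ty C b : b <= 1 -> In (Leaf 0 b) (pool ty C).
Proof.
  intros hb; revert C; induction ty as [|tau ty IH]; intros C; simpl.
  - destruct b as [|[|b]]; auto; lia.
  - apply in_or_app; left; apply IH.
Qed.

(** [X] is an initial segment of the marked levels, highest first. The last clause feeds the
    induction: rows at the next vertex level are looked up in the starting list just added to the
    pool. *)
Lemma envelope_chain X :
  StronglySorted gt X -> (forall z, In z X -> In z marked) ->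
  (forall y z, In y X -> In z marked -> z <= y -> In z X) -> length X <= level_count ->
  exists ty, chain K ty (map layer X) (next_level X) /\ length ty = length X /\
    length (pool ty (map layer X)) <= 2 + length X * subset_count /\
    (forall tau, In tau ty -> length tau <= subset_count /\ incl tau index_pairs) /\
    match X with
    | [] => True
    | y :: X' => incl (map (type_node (next_level X')) (reps y)) (pool ty (map layer X))
    end.
Proof.
  induction X as [|y X IH]; intros hX hXm hXd hlen.
  { exists []; simpl; split; [reflexivity|split; [reflexivity|split; [lia|split; [intros tau []|exact I]]]]. }
  inversion hX as [|? ? hX1 hX2]; subst; rewrite Forall_forall in hX2.
  destruct IH as (ty & hch & hty & hpl & htau & hin); [exact hX1|intros; apply hXm; simpl; auto| |simpl in hlen; lia|].
  { intros z z' hz hz' hle; destruct (hXd y z') as [<-|h]; simpl; auto.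
    - specialize (hX2 z hz); lia.
    - specialize (hX2 z hz); lia. }
  destruct (reps_spec y) as (hr1 & hr2 & hr3 & hr4).
  set (b := next_level X) in *; set (C := map layer X) in *.
  assert (hby : b <= y).
  { unfold b; destruct X as [|y0 X]; simpl; [lia|]; apply hX2; simpl; auto. }
  assert (hgap : forall z, b <= z < y -> ~ In z marked).
  { intros z hz hzm; destruct (hXd y z) as [h|h]; simpl; auto; try lia.
    unfold b in hz; destruct X as [|y0 X]; [exact h|]; simpl in hz.
    inversion hX1 as [|? ? _ h1]; subst; rewrite Forall_forall in h1.
    destruct h as [<-|h]; [lia|specialize (h1 z h); lia]. }
  (* Types that differ at [y] differ already at [b], since no marked level lies between. *)
  assert (hnd : NoDup (map (type_node b) (reps y))).
  { apply (NoDup_map_finer (type_node y)); [|exact hr3].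
    intros W W' hW hW'; destruct (hr1 W hW), (hr1 W' hW'); apply agree_between_marked; auto. }
  assert (htau1 : exists tau, next tau ty C = map (type_node b) (reps y) /\ length tau = length (reps y) /\
     incl tau index_pairs /\ match C with [] => True | P :: _ => forall p, In p tau -> fst p < length P end).
  { unfold next, C, b in *; destruct X as [|y0 X]; simpl map in *; simpl next_level in *.
    - exists (map (fun W => (length W, code W)) (reps y)); simpl; rewrite map_map, length_map.
      split; [reflexivity|split; [reflexivity|split; [|exact I]]].
      intros p hp; apply in_map_iff in hp; destruct hp as (W & <- & hW); destruct (hr1 W hW) as [hW1 _].
      pose proof (subset_length W hW1) as hl.
      assert (hc : code W < list_sum (map K (seq 0 (S n)))).
      { eapply Nat.lt_le_trans; [apply code_lt|]; apply in_list_sum, in_map, in_seq; lia. }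
      pose proof index_bound_spec; apply in_prod_iff; split; apply in_seq; lia.
    - set (pl := pool ty (layer y0 :: map layer X)) in *.
      destruct (reps_spec y0) as (hs1 & hs2 & hs3 & hs4).
      destruct (Forall2_choice (fun p W => Nd (nth (fst p) (layer y0) zleaf) (nth (snd p) pl zleaf) = type_node (S y0) W
          /\ fst p < length (layer y0) /\ snd p < length pl) (reps y)) as [tau ht].
      { intros W hW; destruct (hr1 W hW) as [hW1 hW2].
        assert (h1 : In (type_node y0 W) (layer y0)) by (apply hs4; [exact hW1|lia]).
        (* At a split level the row is one of the two leaves of the pool. At the level of a vertex
           [u], which belongs to [V], it is the type of [u :: W], and the starting list before [y0]
           has level exactly [y0] and contains it. *)
        assert (h2 : In (type_row y0 W) pl).
        { destruct (tag_at y0) as [u|T c] eqn:et.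
          - assert (hu : In u V) by (apply (marked_vertex y0); [apply hXm; simpl; auto|exact et]).
            assert (hy0 := tag_at_Vertex _ _ et).
            assert (huW : In (u :: W) subsets).
            { apply in_subsets; split; [|split; [discriminate|]].
              - apply incr_cons_subset; [exact hW1|]; apply vlevel_lt_inv; unfold top in hW2; lia.
              - intros v [<-|hv]; [exact hu|]; apply in_subsets in hW1; apply hW1, hv. }
            assert (hprev : next_level X = y0).
            { destruct (pre_vlevel u) as (hu1 & _).
              destruct (hXd y0 (vlevel u - 1)) as [h|[h|h]]; simpl; auto; try lia.
              - apply in_or_app; right; apply in_or_app; left; apply (in_map (fun v => vlevel v - 1)), hu.
              - inversion hX1 as [|? ? h3 h4]; subst; rewrite Forall_forall in h4.
                destruct X as [|y1 X]; [destruct h|]; simpl.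
                assert (y1 >= vlevel u - 1); [|specialize (h4 y1 (or_introl eq_refl)); lia].
                destruct h as [<-|h]; [lia|]; inversion h3 as [|? ? _ h5]; subst.
                rewrite Forall_forall in h5; specialize (h5 _ h); lia. }
            rewrite hprev in hin; rewrite hy0, type_row_Vertex, <- hy0.
            apply hin, hs4; [exact huW|]; unfold top; simpl; lia.
          - unfold type_row; simpl; rewrite et; apply pool_leaf.
            destruct (code (T ++ W) =? c); lia. }
        destruct (In_nth _ _ zleaf h1) as (s & hs & es); destruct (In_nth _ _ zleaf h2) as (t & ht & et).
        exists (s, t); simpl fst; simpl snd; rewrite es, et; auto. }
      exists tau; split; [|split; [|split]].
      + apply Forall2_map_eq; revert ht; apply Forall2_impl; intros p W h; apply h.
      + apply (Forall2_length ht).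
      + intros [s t] hp; destruct (Forall2_in_l _ _ _ _ ht hp) as (W & _ & _ & h1 & h2); simpl in h1, h2.
        unfold layer in h1; rewrite length_map in h1; simpl in hpl, hlen.
        assert (hb : length X * subset_count <= level_count * subset_count) by (apply Nat.mul_le_mono_r; lia).
        pose proof index_bound_spec; apply in_prod_iff; split; apply in_seq; simpl; lia.
      + intros p hp; destruct (Forall2_in_l _ _ _ _ ht hp) as (W & _ & _ & h1 & _); exact h1. }
  destruct htau1 as (tau & ht1 & ht2 & ht3 & ht4).
  exists (tau :: ty); split; [|split; [|split; [|split]]].
  - change (chain K (tau :: ty) (layer y :: C) (S y)).
    exists b, y; split; [exact hch|split; [|split; [exact hby|split; [reflexivity|split]]]].
    + unfold valid; rewrite ht1; split; [exact hnd|split; [|exact ht4]].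
      intros p hp; apply in_map_iff in hp; destruct hp as (W & <- & _).
      split; [apply type_node_wf|apply type_node_lev].
    + rewrite ht1; unfold layer; clear - hby; induction (reps y) as [|W R IH]; simpl; constructor; auto.
      apply type_node_ext, hby.
    + intros p hp; apply in_map_iff in hp; destruct hp as (W & <- & _).
      split; [apply type_node_wf|apply type_node_lev].
  - simpl; lia.
  - change (length (pool ty C ++ next tau ty C) <= 2 + S (length X) * subset_count).
    rewrite length_app, ht1, length_map; lia.
  - intros t [<-|ht]; [split; [lia|exact ht3]|apply htau, ht].
  - change (incl (map (type_node b) (reps y)) (pool ty C ++ next tau ty C)); rewrite ht1.
    intros p hp; apply in_or_app; right; exact hp.
Qed.

Lemma envelope_of :
  exists ty des C N, In (ty, des) envelope_types /\ chain K ty C N /\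
    Forall2 (fun p v => fst p < length C /\ snd p < length (nth (fst p) C []) /\
      nth (snd p) (nth (fst p) C []) zleaf = vertex_node v) des V.
Proof.
  destruct (decreasing_exists marked) as (X & hX1 & hX2 & hX3).
  pose proof marked_length as hml; pose proof index_bound_spec as hib.
  destruct (envelope_chain X) as (ty & hch & hty & _ & htau & _); [exact hX1|intros z; apply hX2| |lia|].
  { intros y z _ hz _; apply hX2, hz. }
  destruct (Forall2_choice (fun p v => fst p < length (map layer X) /\
      snd p < length (nth (fst p) (map layer X) []) /\ snd p < subset_count /\
      nth (snd p) (nth (fst p) (map layer X) []) zleaf = vertex_node v) V) as [des hdes].
  { intros v hv.
    assert (hvX : In (vlevel v) X) by (apply hX2, in_or_app; left; apply in_map, hv).
    assert (hvs : In [v] subsets).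
    { apply in_subsets; split; [repeat constructor|split; [discriminate|intros w [<-|[]]; exact hv]]. }
    destruct (reps_spec (vlevel v)) as (_ & h2 & _ & h1).
    assert (h3 : In (vertex_node v) (layer (vlevel v))) by (apply (h1 [v] hvs); apply le_n).
    destruct (In_nth _ _ [] (in_map layer _ _ hvX)) as (i & hi & ei).
    destruct (In_nth _ _ zleaf h3) as (s & hs & es).
    exists (i, s); simpl; rewrite ei; split; [exact hi|split; [exact hs|split; [|exact es]]].
    unfold layer in hs; rewrite length_map in hs; lia. }
  exists ty, des, (map layer X), (next_level X); split; [|split; [exact hch|]].
  - apply in_prod_iff; split.
    + apply bounded_lists_spec; [lia|]; intros tau ht; destruct (htau tau ht).
      apply bounded_lists_spec; [lia|assumption].
    + apply bounded_lists_spec; [rewrite (Forall2_length hdes), HVn; lia|].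
      intros [i s] hp; destruct (Forall2_in_l _ _ _ _ hdes hp) as (v & _ & h1 & _ & h2 & _); simpl in h1, h2.
      rewrite length_map in h1; apply in_prod_iff; split; apply in_seq; lia.
  - revert hdes; apply Forall2_impl; intros p v h; split; [apply h|split; apply h].
Qed.

End Envelope.
End Coding.

(** * The universal structure on the tree *)

(** The types are treated in turn; [chain_copy] keeps what was achieved before, because a copy maps
    chains to chains of the same type. *)
Lemma milliken_list (K : nat -> nat) (k : nat) (l : list (list step_type * (list (list node) -> nat))) :
  0 < K 0 -> (forall p C, In p l -> snd p C < k) ->
  exists f, copy K 0 f /\ forall p, In p l -> exists i, forall C N, chain K (fst p) C N -> snd p (map (map f) C) = i.
Proof.
  intros K0; induction l as [|[ty chi] l IH]; intros hk.
  - exists (fun t => t); split; [apply copy_id|intros p []].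
  - destruct IH as (f & hf & hl); [intros; apply hk; simpl; auto|].
    destruct (milliken K ty (fun C => chi (map (map f) C)) k K0) as (g & hg & i & hi).
    { intros C; apply (hk (ty, chi)); simpl; auto. }
    assert (hm : forall C, map (map (fun t => f (g t))) C = map (map f) (map (map g) C)).
    { intros C; rewrite map_map; apply map_ext; intros P; rewrite map_map; reflexivity. }
    exists (fun t => f (g t)); split; [apply copy_comp; assumption|].
    intros p [<-|hp]; simpl.
    + exists i; intros C N hC; rewrite hm; apply (hi C N hC).
    + destruct (hl p hp) as [j hj]; exists j; intros C N hC; rewrite hm.
      destruct (copy_lev _ _ _ hg) as [x hx].
      apply (hj _ _ (chain_copy K0 hg hx _ _ _ hC)).
Qed.

Lemma classify {A I : Type} (P : I -> A -> Prop) (l : list I) :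
  exists (m : nat) (c : A -> nat), (forall a, c a < m) /\
    forall a a', c a = c a' -> forall i, In i l -> (P i a <-> P i a').
Proof.
  induction l as [|i l (m & c & h1 & h2)].
  - exists 1, (fun _ => 0); split; [auto|intros a a' _ i []].
  - exists (2 * m), (fun a => 2 * c a + if excluded_middle_informative (P i a) then 1 else 0); split.
    + intros a; specialize (h1 a); destruct excluded_middle_informative; lia.
    + intros a a' he j hj; assert (hc : c a = c a') by (repeat destruct excluded_middle_informative in he; lia).
      destruct hj as [<-|hj]; [|apply h2; assumption].
      repeat destruct excluded_middle_informative in he; try tauto; lia.
Qed.

(** In each arity at least two there are finitely many symbols and index patterns, so finitely many
    labels record all relations on a list. Unary relations are left to [same_unary]. *)
Lemma coding_exists {Sym : Type} {ar : Sym -> nat} (H : struc Sym ar) :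
  (forall k, 2 <= k -> exists l : list Sym, forall s, ar s = k -> In s l) ->
  exists (K : nat -> nat) (code : list nat -> nat),
    2 <= K 0 /\ (forall L, code L < K (length L)) /\ (forall L, ~ incr L -> code L = 0) /\
    forall V V' s l, incr V -> incr V' -> length V = length V' -> 2 <= length V -> code V = code V' ->
      ar s = length V -> length l = length V -> incl l (seq 0 (length V)) ->
      (rel H s (map (fun i => nth i V 0) l) <-> rel H s (map (fun i => nth i V' 0) l)).
Proof.
  intros hfin.
  assert (hk : forall k, exists mc : nat * (list nat -> nat), (forall V, snd mc V < fst mc) /\
    (2 <= k -> forall V V' s l, snd mc V = snd mc V' -> ar s = k -> length l = k -> incl l (seq 0 k) ->
      (rel H s (map (fun i => nth i V 0) l) <-> rel H s (map (fun i => nth i V' 0) l)))).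
  { intros k; destruct (le_lt_dec 2 k) as [h|h].
    2:{ exists (1, fun _ => 0); split; [simpl; auto|lia]. }
    destruct (hfin k h) as [Ls hLs].
    destruct (classify (fun (sl : Sym * list nat) V => rel H (fst sl) (map (fun i => nth i V 0) (snd sl)))
      (list_prod Ls (bounded_lists (seq 0 k) k))) as (m & c & h1 & h2).
    exists (m, c); split; [exact h1|]; intros _ V V' s l hc hs hl hi.
    apply (h2 V V' hc (s, l)), in_prod_iff; split; [apply hLs, hs|apply bounded_lists_spec; [lia|exact hi]]. }
  pose (mc := fun k => choose (0, fun _ : list nat => 0) (fun mc : nat * (list nat -> nat) =>
    (forall V, snd mc V < fst mc) /\
    (2 <= k -> forall V V' s l, snd mc V = snd mc V' -> ar s = k -> length l = k -> incl l (seq 0 k) ->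
      (rel H s (map (fun i => nth i V 0) l) <-> rel H s (map (fun i => nth i V' 0) l))))).
  assert (hmc := fun k => choose_spec (0, fun _ : list nat => 0) _ (hk k)).
  (* Rank 0 gets at least two labels for the two rows of a split level. *)
  exists (fun k => fst (mc k) + 1 + (if k =? 0 then 1 else 0)),
    (fun L => if excluded_middle_informative (incr L) then snd (mc (length L)) L else 0).
  split; [simpl; lia|split; [|split]].
  - intros L; destruct (hmc (length L)) as [h _]; specialize (h L); fold (mc (length L)) in h.
    destruct excluded_middle_informative; lia.
  - intros L hL; destruct excluded_middle_informative; [contradiction|reflexivity].
  - intros V V' s l hV hV' hlen h2 hc hs hl hi.
    destruct excluded_middle_informative as [_|]; [|contradiction].
    destruct excluded_middle_informative as [_|]; [|contradiction].
    rewrite <- hlen in hc; apply (proj2 (hmc (length V)) h2); assumption.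
Qed.

(** Finitely many well-formed rank-one nodes with a label at most their level occur on each level,
    so such pairs are enumerated level by level; monotone self-embeddings need precisely this
    order. *)
Lemma numbering_exists (K : nat -> nat) :
  exists nu : node -> nat -> nat,
    (forall t w t' w', wf K t -> rk t = 1 -> w <= lev t -> wf K t' -> rk t' = 1 -> w' <= lev t' ->
       lev t < lev t' -> nu t w < nu t' w') /\
    (forall t w t' w', wf K t -> rk t = 1 -> w <= lev t -> wf K t' -> rk t' = 1 -> w' <= lev t' ->
       nu t w = nu t' w' -> t = t' /\ w = w').
Proof.
  pose (prs := fun l => list_prod (all_nodes K l 1) (seq 0 (S l))).
  pose (base := fix base l := match l with 0 => 0 | S l => base l + length (prs l) end).
  pose (idx := fun t w => choose 0 (fun i => i < length (prs (lev t)) /\ nth i (prs (lev t)) (zleaf, 0) = (t, w))).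
  assert (hidx : forall t w, wf K t -> rk t = 1 -> w <= lev t ->
    idx t w < length (prs (lev t)) /\ nth (idx t w) (prs (lev t)) (zleaf, 0) = (t, w)).
  { intros t w h1 h2 h3.
    apply (choose_spec 0 (fun i => i < length (prs (lev t)) /\ nth i (prs (lev t)) (zleaf, 0) = (t, w))).
    apply In_nth, in_prod_iff; split; [|apply in_seq; lia].
    rewrite <- h2; apply all_nodes_spec; auto. }
  assert (hbase : forall l l', l < l' -> base l + length (prs l) <= base l').
  { intros l l' h; induction h as [|l' h IH]; [apply le_n|]; simpl; unfold lt in *; lia. }
  assert (hlt : forall t w t' w', wf K t -> rk t = 1 -> w <= lev t -> wf K t' -> rk t' = 1 -> w' <= lev t' ->
       lev t < lev t' -> base (lev t) + idx t w < base (lev t') + idx t' w').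
  { intros t w t' w' h1 h2 h3 h4 h5 h6 h; pose proof (hbase _ _ h); destruct (hidx t w h1 h2 h3); lia. }
  exists (fun t w => base (lev t) + idx t w); split; [exact hlt|].
  intros t w t' w' h1 h2 h3 h4 h5 h6 h.
  destruct (lt_eq_lt_dec (lev t) (lev t')) as [[hl|hl]|hl].
  - pose proof (hlt t w t' w' h1 h2 h3 h4 h5 h6 hl); lia.
  - destruct (hidx t w h1 h2 h3) as [_ e1], (hidx t' w' h4 h5 h6) as [_ e2].
    rewrite hl in h; replace (idx t' w') with (idx t w) in e2 by lia.
    rewrite hl, e2 in e1; injection e1 as <- <-; auto.
  - pose proof (hlt t' w' t w h4 h5 h6 h1 h2 h3 hl); lia.
Qed.

Lemma least_exists (P : nat -> Prop) : (exists n, P n) -> exists n, P n /\ forall m, P m -> n <= m.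
Proof.
  intros [n hn]; induction n as [n IH] using lt_wf_ind.
  destruct (classic (exists m, m < n /\ P m)) as [(m & h1 & h2)|h]; [apply (IH m h1 h2)|].
  exists n; split; [exact hn|]; intros m hm; destruct (le_lt_dec n m); [assumption|].
  exfalso; apply h; exists m; auto.
Qed.

Lemma copy_lev_ge K N f t : copy K N f -> wf K t -> lev t <= lev (f t).
Proof.
  intros hf; induction t as [j c|a IH r _]; intros ht; simpl; [lia|].
  pose proof (ext_lev _ _ (copy_ext _ _ _ hf _ ht)) as h; simpl in h; specialize (IH (proj1 ht)); lia.
Qed.

Lemma incr_list_of (t : list nat) : exists L, incr L /\ forall y, In y L <-> In y t.
Proof.
  destruct (decreasing_exists t) as (X & h1 & h2 & _); exists (rev X); split.
  - clear h2; induction h1 as [|a X h IH ha]; simpl; [constructor|].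
    rewrite Forall_forall in ha.
    assert (hr : forall b, In b (rev X) -> b < a) by (intros b hb; apply in_rev in hb; apply ha, hb).
    clear ha h; induction (rev X) as [|b Y IHY]; simpl; [repeat constructor|].
    inversion IH as [|? ? h3 h4]; subst; constructor; [apply IHY; auto; intros; apply hr; simpl; auto|].
    apply Forall_app; split; [exact h4|]; constructor; [apply hr; simpl; auto|constructor].
  - intros y; rewrite <- in_rev; apply h2.
Qed.

Lemma incr_map (f : nat -> nat) (L : list nat) :
  (forall a b, In a L -> In b L -> a < b -> f a < f b) -> incr L -> incr (map f L).
Proof.
  intros hf h; induction h as [|a L h IH ha]; simpl; [constructor|]; rewrite Forall_forall in ha.
  constructor; [apply IH; intros; apply hf; simpl; auto|].
  apply Forall_forall; intros y hy; apply in_map_iff in hy; destruct hy as (b & <- & hb).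
  apply hf; simpl; auto.
Qed.

Section Universal.
Context {Sym : Type} {ar : Sym -> nat}.
Variable H : struc Sym ar.
Hypothesis ar_pos : forall s, 1 <= ar s.
Hypothesis Hsize : size H = None.
Hypothesis Hinj : all_rel_injective H.
Variable code : list nat -> nat.
Hypothesis code_rel : forall V V' s l, incr V -> incr V' -> length V = length V' -> 2 <= length V ->
  code V = code V' -> ar s = length V -> length l = length V -> incl l (seq 0 (length V)) ->
  (rel H s (map (fun i => nth i V 0) l) <-> rel H s (map (fun i => nth i V' 0) l)).

Lemma in_infinite v : inS H v.
Proof. unfold inS; rewrite Hsize; exact I. Qed.

Definition same_unary (v w : nat) : Prop := forall s, ar s = 1 -> (rel H s [v] <-> rel H s [w]).

(** The least representative is at most [v], hence at most the level of the node of [v], and so is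
    an admissible label for [nu] even with infinitely many unary types. *)
Definition unary_rep (v : nat) : nat :=
  choose 0 (fun w => same_unary v w /\ forall w', same_unary v w' -> w <= w').

Lemma unary_rep_spec v : same_unary v (unary_rep v) /\ forall w', same_unary v w' -> unary_rep v <= w'.
Proof.
  apply (choose_spec 0 (fun w => same_unary v w /\ forall w', same_unary v w' -> w <= w')).
  apply least_exists; exists v; intros s _; tauto.
Qed.

Lemma same_unary_trans u v w : same_unary v u -> same_unary v w -> same_unary u w.
Proof. intros h h' s hs; rewrite <- (h s hs); apply h', hs. Qed.

Lemma unary_rep_eq v w : same_unary v w -> unary_rep v = unary_rep w.
Proof.
  intros h; destruct (unary_rep_spec v) as [h1 h2], (unary_rep_spec w) as [h3 h4]; apply Nat.le_antisymm.
  - apply h2; intros s hs; rewrite (h s hs); apply h3, hs.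
  - apply h4; eapply same_unary_trans; eassumption.
Qed.

(** Vertex [g] of the universal structure stands for the node [node_of g] with the unary type of the vertex
    [unary_of g] of [H]. *)
Variables (node_of : nat -> node) (unary_of : nat -> nat).

Definition realization (f : nat -> nat) (t : list nat) : Prop :=
  (forall a b, In a t -> In b t -> a < b -> f a < f b) /\
  (forall a, In a t -> same_unary (f a) (unary_of a)) /\
  (forall L, incl L t -> incr L -> 2 <= length L -> code (map f L) = read_code (map node_of L)).

Definition universal_rel (s : Sym) (t : list nat) : Prop := exists f, realization f t /\ rel H s (map f t).

Lemma realization_incl f t t' : incl t' t -> realization f t -> realization f t'.
Proof.
  intros hi (h1 & h2 & h3); split; [|split]; auto.
  intros L hL; apply h3; eapply incl_tran; eassumption.
Qed.

(** Any two realizations of [t] agree in codes and unary types. By injectivity of the relations the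
    entries of [t] are distinct, so their increasing list has length [ar s], and its code decides
    the relation in arity at least two. *)
Lemma realization_rel f t s : realization f t -> (universal_rel s t <-> rel H s (map f t)).
Proof.
  intros (h1 & h2 & h3); split; [|intros h; exists f; split; [split; auto|exact h]].
  intros (f' & (h1' & h2' & h3') & hrel).
  assert (hlen : length t = ar s) by (apply (rel_wf _ _ H) in hrel; destruct hrel as [h _]; rewrite length_map in h; exact h).
  assert (hnd : NoDup t) by (apply Hinj, NoDup_map_inv in hrel; exact hrel).
  destruct (le_lt_dec 2 (length t)) as [hk|hk].
  - destruct (incr_list_of t) as (L & hL & hLt).
    assert (hLlen : length L = length t).
    { apply Nat.le_antisymm; apply NoDup_incl_length; auto using incr_NoDup; intros y; apply hLt. }
    destruct (Forall2_choice (fun i y => i < length L /\ nth i L 0 = y) t) as [l hl].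
    { intros y hy; apply hLt in hy; destruct (In_nth _ _ 0 hy) as (i & hi & e); exists i; auto. }
    assert (hmap : forall g : nat -> nat, map g t = map (fun i => nth i (map g L) 0) l).
    { intros g; symmetry; apply Forall2_map_eq; revert hl; apply Forall2_impl; intros i y [hi <-].
      rewrite nth_indep with (d' := g 0) by (rewrite length_map; exact hi); apply map_nth. }
    assert (hLi : incl L t) by (intros y; apply hLt).
    rewrite hmap in hrel |- *.
    apply (code_rel (map f' L) (map f L)); rewrite ?length_map; try lia.
    + apply incr_map; auto.
    + apply incr_map; auto.
    + rewrite h3, h3'; auto; lia.
    + rewrite (Forall2_length hl); lia.
    + intros i hi; destruct (Forall2_in_l _ _ _ _ hl hi) as (y & _ & h & _); apply in_seq; lia.
    + exact hrel.
  - pose proof (ar_pos s); destruct t as [|a [|b t]]; simpl in *; try lia.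
    rewrite (h2 a (or_introl eq_refl) s (eq_sym hlen)), <- (h2' a (or_introl eq_refl) s (eq_sym hlen)); exact hrel.
Qed.

Lemma universal_wf s t : universal_rel s t -> length t = ar s /\ Forall (inV None) t.
Proof.
  intros (f & _ & h); apply (rel_wf _ _ H) in h; destruct h as [h _]; rewrite length_map in h.
  split; [exact h|]; apply Forall_forall; intros; exact I.
Qed.

Definition universal_struc : struc Sym ar := Struc _ _ None universal_rel universal_wf.

(** A covering tuple of [F] in the universal structure has a realization; as it contains all
    vertices of [F], that realization restricts to every tuple of [F] and embeds [F] into [H]. *)
Lemma universal_free (Fam : struc Sym ar -> Prop) :
  (forall F, Fam F -> is_finite F /\ covered F) -> free Fam H -> free Fam universal_struc.
Proof.
  intros hFam hfree F hF [g (_ & hg2 & hg3)].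
  destruct (proj2 (hFam F hF)) as (s0 & t0 & hrel0 & hcov).
  destruct (rel_wf _ _ F _ _ hrel0) as [hlen0 hin0].
  apply (hg3 s0 t0 hlen0 hin0) in hrel0; destruct hrel0 as (f & hf & _).
  apply (hfree F hF); exists (fun x => f (g x)); split; [|split].
  - intros x _; apply in_infinite.
  - intros x y hx hy hxy; apply hf; try (apply in_map, hcov; assumption); auto.
  - intros s t hlen hin; rewrite (hg3 s t hlen hin); simpl.
    rewrite (realization_rel f); [rewrite map_map; tauto|].
    apply (realization_incl f (map g t0)); [|exact hf].
    intros y hy; apply in_map_iff in hy; destruct hy as (x & <- & hx); apply in_map, hcov.
    rewrite Forall_forall in hin; apply hin, hx.
Qed.

End Universal.

(** * Big Ramsey degrees *)

Lemma finite_structure_big_ramsey {Sym : Type} {ar : Sym -> nat} (H : struc Sym ar) (m : nat) :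
  size H = Some m -> finite_big_ramsey_degrees H.
Proof.
  intros hm A n hA _; exists (length (bounded_lists (seq 0 m) n)); intros k chi hk.
  exists (fun x => x); split.
  - split; [auto|split; [auto|]]; intros s t _ _; rewrite map_id; tauto.
  - exists (map chi (bounded_lists (seq 0 m) n)); split; [rewrite length_map; apply le_n|].
    intros g (hg & _ & _) _; apply in_map, bounded_lists_spec; [rewrite length_map, length_seq; apply le_n|].
    intros y hy; apply in_map_iff in hy; destruct hy as (x & <- & hx); apply in_seq in hx.
    apply in_seq; specialize (hg x); unfold inS in hg; rewrite hm, hA in hg; simpl in hg; lia.
Qed.

Section Infinite.
Context {Sym : Type} {ar : Sym -> nat}.
Variable H : struc Sym ar.
Hypothesis ar_pos : forall s, 1 <= ar s.
Hypothesis Hsize : size H = None.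
Hypothesis Hinj : all_rel_injective H.
Hypothesis Hunr : unrestricted H.
Variables (K : nat -> nat) (code : list nat -> nat).
Hypothesis K0 : 2 <= K 0.
Hypothesis code_lt : forall L, code L < K (length L).
Hypothesis code_incr : forall L, ~ incr L -> code L = 0.
Hypothesis code_rel : forall V V' s l, incr V -> incr V' -> length V = length V' -> 2 <= length V ->
  code V = code V' -> ar s = length V -> length l = length V -> incl l (seq 0 (length V)) ->
  (rel H s (map (fun i => nth i V 0) l) <-> rel H s (map (fun i => nth i V' 0) l)).
Variable nu : node -> nat -> nat.
Hypothesis nu_lt : forall t w t' w', wf K t -> rk t = 1 -> w <= lev t -> wf K t' -> rk t' = 1 -> w' <= lev t' ->
  lev t < lev t' -> nu t w < nu t' w'.
Hypothesis nu_inj : forall t w t' w', wf K t -> rk t = 1 -> w <= lev t -> wf K t' -> rk t' = 1 -> w' <= lev t' ->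
  nu t w = nu t' w' -> t = t' /\ w = w'.

Let decode (g : nat) : node * nat :=
  choose (zleaf, 0) (fun tw => (wf K (fst tw) /\ rk (fst tw) = 1 /\ snd tw <= lev (fst tw)) /\ nu (fst tw) (snd tw) = g).
Let node_of (g : nat) : node := fst (decode g).
Let unary_of (g : nat) : nat := snd (decode g).

Lemma decode_nu t w : wf K t -> rk t = 1 -> w <= lev t -> node_of (nu t w) = t /\ unary_of (nu t w) = w.
Proof.
  intros h1 h2 h3; unfold node_of, unary_of, decode.
  set (P := fun tw => _).
  assert (hP : P (choose (zleaf, 0) P)) by (apply choose_spec; exists (t, w); repeat split; auto).
  destruct (choose (zleaf, 0) P) as [t' w']; destruct hP as ((h4 & h5 & h6) & h7); simpl in *.
  destruct (nu_inj t' w' t w); auto.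
Qed.

Lemma universal_embedding : exists p, is_emb (universal_struc H code node_of unary_of) H p.
Proof.
  destruct Hunr as (Fam & h1 & h2 & h3); apply h3.
  apply (universal_free H ar_pos Hsize Hinj code code_rel); assumption.
Qed.

Variable n : nat.
Let vnode := vertex_node K code n.

Section SelfEmbedding.
Variables (f : node -> node) (p : nat -> nat).
Hypothesis Hf : copy K 0 f.
Hypothesis Hp : is_emb (universal_struc H code node_of unary_of) H p.

Let gam (v : nat) : nat := nu (f (vnode v)) (unary_rep H v).

Lemma vnode_wf v : wf K (vnode v).
Proof. apply type_node_wf; assumption. Qed.

Lemma image_valid v : wf K (f (vnode v)) /\ rk (f (vnode v)) = 1 /\ unary_rep H v <= lev (f (vnode v)).
Proof.
  pose proof (vnode_wf v) as hw; split; [apply (copy_wf _ _ _ Hf _ hw)|split].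
  - rewrite (copy_rk Hf _ hw); apply type_node_rk.
  - pose proof (copy_lev_ge _ _ _ _ Hf hw) as h1.
    assert (h2 : lev (vnode v) = vlevel K n v) by apply type_node_lev.
    pose proof (vlevel_ge K n v) as h3.
    assert (h4 : unary_rep H v <= v) by (apply (unary_rep_spec H v); intros s _; tauto).
    lia.
Qed.

Lemma gam_lt v w : v < w -> gam v < gam w.
Proof.
  intros h; destruct (image_valid v) as (h1 & h2 & h3), (image_valid w) as (h4 & h5 & h6).
  apply nu_lt; auto; apply (copy_lev_lt Hf); try apply vnode_wf.
  unfold vnode, vertex_node; rewrite !type_node_lev; apply vlevel_mono, h.
Qed.

(** The inverse of [gam] is a realization: unary types agree by the choice of label, and codes are
    read back by [read_code_copy] since [f] is a copy. Hence [gam] embeds [H] into the universal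
    structure. *)
Lemma gam_realization t :
  exists d, (forall v, d (gam v) = v) /\ realization H code node_of unary_of d (map gam t).
Proof.
  pose (d := fun g => choose 0 (fun v => gam v = g)).
  assert (hd : forall v, d (gam v) = v).
  { intros v; assert (h : gam (d (gam v)) = gam v) by (apply (choose_spec 0 (fun w => gam w = gam v)); exists v; reflexivity).
    destruct (lt_eq_lt_dec (d (gam v)) v) as [[h'|h']|h']; [|exact h'|]; apply gam_lt in h'; lia. }
  exists d; split; [exact hd|split; [|split]].
  - intros a b ha hb hab; apply in_map_iff in ha, hb; destruct ha as (v & <- & _), hb as (w & <- & _).
    rewrite !hd; destruct (lt_eq_lt_dec v w) as [[h|h]|h]; [exact h|subst; lia|apply gam_lt in h; lia].
  - intros a ha; apply in_map_iff in ha; destruct ha as (v & <- & _); rewrite hd.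
    destruct (image_valid v) as (h1 & h2 & h3); unfold gam; rewrite (proj2 (decode_nu _ _ h1 h2 h3)).
    apply unary_rep_spec.
  - intros L hL hinc hlen.
    assert (hLd : L = map gam (map d L)).
    { rewrite map_map; rewrite <- (map_id L) at 1; apply map_ext_in; intros a ha.
      apply hL, in_map_iff in ha; destruct ha as (v & <- & _); rewrite hd; reflexivity. }
    rewrite hLd at 2; rewrite map_map.
    rewrite (map_ext _ (fun v => f (vnode v))).
    2:{ intros v; destruct (image_valid v) as (h1 & h2 & h3); apply (decode_nu _ _ h1 h2 h3). }
    assert (hinc' : incr (map d L)).
    { apply incr_map; [|exact hinc]; intros a b ha hb hab.
      apply hL, in_map_iff in ha; apply hL, in_map_iff in hb; destruct ha as (v & <- & _), hb as (w & <- & _).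
      rewrite !hd; destruct (lt_eq_lt_dec v w) as [[h|h]|h]; [exact h|subst; lia|apply gam_lt in h; lia]. }
    destruct (exists_last (l := map d L)) as (U & w & e).
    { destruct L; [simpl in hlen; lia|discriminate]. }
    rewrite e in *; symmetry; apply read_code_copy; assumption.
Qed.

Lemma self_embedding : is_emb H H (fun v => p (gam v)).
Proof.
  destruct Hp as (_ & hp2 & hp3); split; [|split].
  - intros x _; apply (in_infinite H Hsize).
  - intros x y _ _ hxy; apply hp2; try exact I; apply gam_lt, hxy.
  - intros s t hlen _; destruct (gam_realization t) as (d & hd & hr).
    rewrite <- (map_map gam p).
    rewrite <- (hp3 s (map gam t)); [|rewrite length_map; exact hlen|apply Forall_forall; intros; exact I].
    simpl; rewrite (realization_rel H ar_pos Hinj code code_rel _ _ d) by exact hr.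
    rewrite map_map, (map_ext _ (fun v => v)), map_id by exact hd; tauto.
Qed.

End SelfEmbedding.

Theorem infinite_big_ramsey (A : struc Sym ar) (g0 : nat -> nat) :
  size A = Some n -> is_emb A H g0 ->
  exists l : nat, forall (k : nat) (chi : list nat -> nat), (forall e, chi e < k) ->
    exists f, is_emb H H f /\ exists cs : list nat, length cs <= l /\
      forall g, is_emb A H g -> (forall x, inS A x -> exists y, inS H y /\ g x = f y) ->
        In (chi (map g (seq 0 n))) cs.
Proof.
  intros hA hg0; exists (length (envelope_types K n)); intros k chi hk.
  destruct universal_embedding as [p hp].
  pose (deref := fun (C : list (list node)) (q : nat * nat) => nth (snd q) (nth (fst q) C []) zleaf).
  (* The colour of the tuple whose nodes sit at the positions [des] of [C]. The labels come from the
     fixed embedding [g0], so only the nodes vary. *)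
  pose (col := fun (des : list (nat * nat)) (C : list (list node)) =>
    chi (map (fun i => p (nu (deref C (nth i des (0, 0))) (unary_rep H (g0 i)))) (seq 0 n))).
  destruct (milliken_list K k (map (fun td => (fst td, col (snd td))) (envelope_types K n)))
    as (f & hf & hcol); [lia| |].
  { intros q C hq; apply in_map_iff in hq; destruct hq as (td & <- & _); apply hk. }
  pose proof (self_embedding f p hf hp) as hemb; set (F := fun v => p (nu (f (vnode v)) (unary_rep H v))) in *.
  exists F; split; [exact hemb|].
  exists (map (fun td => choose 0 (fun i => forall C N, chain K (fst td) C N ->
    col (snd td) (map (map f) C) = i)) (envelope_types K n)).
  split; [rewrite length_map; apply le_n|]; intros g hg himg.
  assert (hin : forall x, x < n -> inS A x) by (intros x hx; unfold inS; rewrite hA; exact hx).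
  pose (y := fun x => choose 0 (fun v => g x = F v)).
  assert (hy : forall x, x < n -> g x = F (y x)).
  { intros x hx; apply (choose_spec 0 (fun v => g x = F v)).
    destruct (himg x (hin x hx)) as (v & _ & hv); exists v; exact hv. }
  assert (hylen : length (map y (seq 0 n)) = n) by (rewrite length_map, length_seq; reflexivity).
  (* The preimages under [F] of the vertices of the copy have their nodes at positions [des] of a
     chain of a listed type; applying [f] to this chain yields the nodes of the copy. *)
  destruct (envelope_of K code n K0 code_lt code_incr (map y (seq 0 n)) hylen)
    as (ty & des & C & N & hty & hch & hdes).
  apply in_map_iff; exists (ty, des); split; [|exact hty]; simpl.
  assert (hconst : exists i, forall C N, chain K ty C N -> col des (map (map f) C) = i).
  { apply (hcol (ty, col des)); apply (in_map (fun td => (fst td, col (snd td))) _ (ty, des)), hty. }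
  apply (choose_spec 0) in hconst; rewrite <- (hconst C N hch); unfold col; f_equal.
  apply map_ext_in; intros x hx; apply in_seq in hx.
  destruct (Forall2_nth_iff _ _ _ (0, 0) 0 hdes) as [_ hnth].
  specialize (hnth x); rewrite length_map, length_seq in hnth.
  destruct hnth as (h1 & h2 & h3); [lia|]; set (q := nth x des (0, 0)) in *.
  assert (hyx : nth x (map y (seq 0 n)) 0 = y x).
  { rewrite nth_indep with (d' := y 0) by (rewrite length_map, length_seq; lia).
    rewrite map_nth, seq_nth by lia; reflexivity. }
  rewrite hyx in h3.
  rewrite hy by lia; unfold F; f_equal; f_equal.
  - unfold deref; change (@nil node) with (map f []); rewrite map_nth.
    rewrite nth_indep with (d' := f zleaf) by (rewrite length_map; exact h2).
    rewrite map_nth, h3; reflexivity.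
  (* Both [g0 x] and [g x] have the unary type of [x] in [A], and [F] preserves that of [y x], so
     the labels coincide. *)
  - apply unary_rep_eq; intros s hs.
    assert (hA1 : rel H s [g0 x] <-> rel H s [g x]).
    { transitivity (rel A s [x]); [symmetry; apply (proj2 (proj2 hg0) s [x])|apply (proj2 (proj2 hg) s [x])];
        auto; constructor; auto; apply hin; lia. }
    rewrite hA1, hy by lia; symmetry; apply (proj2 (proj2 hemb) s [y x]); [auto|].
    constructor; [apply (in_infinite H Hsize)|constructor].
Qed.

End Infinite.

Theorem theorem1p1 (Sym : Type) (ar : Sym -> nat)
  (ar_pos : forall s, 1 <= ar s)
  (fin_arity : forall k, 2 <= k -> exists l : list Sym, forall s, ar s = k -> In s l)
  (countable : exists enc : Sym -> nat, forall s1 s2, enc s1 = enc s2 -> s1 = s2)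
  (H : struc Sym ar)
  (Hunr : unrestricted H)
  (Hinj : all_rel_injective H) :
  finite_big_ramsey_degrees H.
Proof.
  destruct (size H) as [m|] eqn:hsize; [apply (finite_structure_big_ramsey H m hsize)|].
  destruct (coding_exists H fin_arity) as (K & code & h1 & h2 & h3 & h4).
  destruct (numbering_exists K) as (nu & h5 & h6).
  intros A n hA [g0 hg0].
  apply (infinite_big_ramsey H ar_pos hsize Hinj Hunr K code h1 h2 h3 h4 nu h5 h6 n A g0 hA hg0).
Qed.
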